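(* Let $(E,\rho)$ be a weighted space and $(P(t))_{t\ge0}$ a generalized Feller semigroup on $\mathscr{B}^\rho(E)$ such that $P(t)1=1$ for all $t\ge0$. Then for every probability measure $\nu\in\mathcal{M}^\rho(E)$ there exist a probability measure $\mathbb{P}_\nu$ on the measurable space $(E^{\mathbb{R}_+},\mathcal{B}(E)^{\mathbb{R}_+})$ (product σ-algebra) and a complete, right-continuous filtration $(\mathcal{F}_t)_{t\ge0}$ containing the natural filtration of the canonical (coordinate) process $(\lambda_t)_{t\ge0}$, such that $(\lambda_t)$ is $(\mathcal{F}_t)$-adapted, $\mathbb{P}_\nu\circ\lambda_0^{-1}=\nu$, and for all $t\ge s\ge0$ and all $f\in\mathscr{B}^\rho(E)$, $$\mathbb{E}_\nu[f(\lambda_t)\mid\mathcal{F}_s]=P(t-s)f(\lambda_s)\quad \mathbb{P}_\nu\text{-a.s.}$$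
   Context: A weighted space is a pair $(E,\rho)$ where $E$ is a completely regular Hausdorff topological space and $\rho:E\to(0,\infty)$ is an admissible weight function, meaning that for every $R\ge 0$ the sublevel set $K_R:=\{x\in E:\rho(x)\le R\}$ is compact. For $f:E\to\mathbb{R}$ put $\|f\|_\rho:=\sup_{x\in E}|f(x)|/\rho(x)$; $\mathscr{B}^\rho(E)$ denotes the closure of $C_b(E)$ with respect to $\|\cdot\|_\rho$ inside $\{f:E\to\mathbb{R}:\|f\|_\rho<\infty\}$. A generalized Feller semigroup on $\mathscr{B}^\rho(E)$ is a family $(P(t))_{t\ge0}$ of bounded linear operators on $\mathscr{B}^\rho(E)$ such that (P1) $P(0)=\mathrm{Id}$; (P2) $P(t+s)=P(s)P(t)$ for all $s,t\ge0$; (P3) $\lim_{t\downarrow0}P(t)f(x)=f(x)$ for all $f\in\mathscr{B}^\rho(E)$, $x\in E$; (P4) there exist $\varepsilon>0$, $C<\infty$ with $\|P(t)\|_{L(\mathscr{B}^\rho(E))}\le C$ for all $t\in[0,\varepsilon]$; (P5) each $P(t)$ is a positive operator. $\mathcal{M}^\rho(E)$ denotes the set of signed Radon measures $\mu$ on the Borel σ-algebra $\mathcal{B}(E)$ with $\int_E\rho\,d|\mu|<\infty$. $\mathcal{B}(E)$ is the Borel σ-algebra of $E$. *)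

(* Defs.v *)
From HB Require Import structures.
From mathcomp Require Import all_boot all_order all_algebra.
From mathcomp Require Import all_classical all_reals all_analysis.

Set Implicit Arguments.
Unset Strict Implicit.
Unset Printing Implicit Defensive.

Import Order.TTheory GRing.Theory Num.Theory.
Import numFieldNormedType.Exports.

Local Open Scope classical_set_scope.
Local Open Scope ring_scope.

Section WeightedSpaces.
Context {R : realType}.

Definition admissible_weight (E : topologicalType) (rho : E -> R) : Prop :=
  (forall x, 0 < rho x) /\
  (forall r : R, 0 <= r -> compact [set x | rho x <= r]).

Definition rho_norm (E : Type) (rho : E -> R) (f : E -> R) : \bar R :=
  ereal_sup [set (`|f x| / rho x)%:E | x in [set: E]].

Definition Cb (E : topologicalType) (f : E -> R) : Prop :=
  continuous f /\ exists M : R, forall x, `|f x| <= M.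

Definition Brho (E : topologicalType) (rho : E -> R) (f : E -> R) : Prop :=
  (rho_norm rho f < +oo)%E /\
  forall e : R, 0 < e ->
    exists g : E -> R, Cb g /\ (rho_norm rho (fun x => (f x - g x)%R) < e%:E)%E.

Definition bounded_linear_op (E : topologicalType) (rho : E -> R)
    (T : (E -> R) -> (E -> R)) : Prop :=
  (forall f, Brho rho f -> Brho rho (T f)) /\
  (forall (a : R) f g, Brho rho f -> Brho rho g ->
     T (fun x => a * f x + g x) = (fun x => a * T f x + T g x)) /\
  (exists C : R, forall f, Brho rho f ->
     (rho_norm rho (T f) <= C%:E * rho_norm rho f)%E).

Definition generalized_Feller (E : topologicalType) (rho : E -> R)
    (P : R -> (E -> R) -> (E -> R)) : Prop :=
  (forall t, 0 <= t -> bounded_linear_op rho (P t)) /\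
  (forall f, Brho rho f -> P 0 f = f) /\
  (forall s t f, 0 <= s -> 0 <= t -> Brho rho f -> P (t + s) f = P s (P t f)) /\
  (forall f x, Brho rho f -> (fun t => P t f x) @ 0^'+ --> f x) /\
  (exists eps C : R, 0 < eps /\
     forall t f, 0 <= t <= eps -> Brho rho f ->
       (rho_norm rho (P t f) <= C%:E * rho_norm rho f)%E) /\
  (forall t f, 0 <= t -> Brho rho f -> (forall x, 0 <= f x) ->
     forall x, 0 <= P t f x).

End WeightedSpaces.

Definition Borel (E : ptopologicalType) := g_sigma_algebraType (@open E).

Definition in_Mrho {R : realType} (E : ptopologicalType) (rho : E -> R)
    (nu : probability (Borel E) R) : Prop :=
  (forall A : set (Borel E), measurable A ->
     nu A = ereal_sup [set nu K | K in [set K : set (Borel E) |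
                                         @compact E K /\ K `<=` A]]) /\
  (\int[nu]_x (rho x)%:E < +oo)%E.

Definition cylinders (R : realType) (E : ptopologicalType) :
    set (set ({nonneg R} -> E)) :=
  [set A | exists (t : {nonneg R}) (B : set E),
             <<s @open E >> B /\ A = (fun w => w t) @^-1` B].

Definition Path (R : realType) (E : ptopologicalType) :=
  g_sigma_algebraType (@cylinders R E).

Definition canon_proc {R : realType} {E : ptopologicalType} (t : {nonneg R})
  (w : Path R E) : E := w t.

Definition natural_filtration {R : realType} {E : ptopologicalType}
    (t : {nonneg R}) : set (set (Path R E)) :=
  <<s [set A | exists (u : {nonneg R}) (B : set E),
             u%:num <= t%:num /\ <<s @open E >> B /\ A = canon_proc u @^-1` B] >>.

Definition cond_exp_ae {R : realType} d (T : measurableType d)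
    (P : probability T R) (G : set (set T)) (X Y : T -> R) : Prop :=
  P.-integrable setT (EFin \o X) /\
  exists Z : T -> R,
    (forall B : set R, measurable B -> G (Z @^-1` B)) /\
    P.-integrable setT (EFin \o Z) /\
    (forall A, G A -> (\int[P]_(w in A) (X w)%:E = \int[P]_(w in A) (Z w)%:E)%E) /\
    {ae P, forall w, Y w = Z w}.

(* Main.v *)
(** The path measure is constructed directly on [E^{R_+}], without transition
kernels.  Let [A] be the algebra of bounded elements of [B^rho(E)]; it is
uniformly closed and stable under every [P(t)].  On the uniformly closed
algebra of cylinder functions built from [A] over finitely many times, iterating
the semigroup along the sorted times and integrating against [nu] gives a
consistent positive unital functional [L].

Call a set of paths open when it depends on countably many times and is a union
of sets [Phi > 0] with [Phi] a cylinder function.  The set function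
[lam U = sup {L Phi | 0 <= Phi <= 1_U}] is countably subadditive on open sets:
by the weight bound on [P(t)] the functional is small on cylinder functions
vanishing on a suitable product of sublevel sets of [rho], and such a product is
compact by Tychonoff.  Caratheodory's construction then yields the probability
[Q], for which [Q U = lam U] on open sets and [E_Q Phi = L Phi].

The Markov property holds for cylinder functions by construction of [L], and
extends to the natural filtration by approximating indicators of open sets from
below.  To pass to the right limits, note that for bounded [f] in [B^rho(E)]
[E (f(lambda_{t+h}) - f(lambda_t))^2 = E [(P_h f^2 - 2 f P_h f + f^2)(lambda_t)]]
tends to [0], so that one may let [h] tend to [0] in
[E [f(lambda_{t+h}) 1_A] = E [P(t-s)f(lambda_{s+h}) 1_A]]; shifting both times
avoids any left continuity, hence strong continuity, of the semigroup. *)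

Require Import Defs.
From HB Require Import structures.
From mathcomp Require Import all_boot all_order all_algebra.
From mathcomp Require Import all_classical all_reals all_analysis.
From mathcomp Require Import measurable_realfun ring lra.

Import Order.TTheory GRing.Theory Num.Theory.
Import numFieldNormedType.Exports.

Set Implicit Arguments.
Unset Strict Implicit.
Unset Printing Implicit Defensive.

Local Open Scope classical_set_scope.
Local Open Scope ring_scope.

(** Elements of [bBrho rho] need not be continuous on [E]; they are continuous only along each
    sublevel set of [rho]. Sets [Phi > 0] are therefore not open in the product topology in general,
    and compactness has to be used inside a product of sublevel sets. Leaving this product costs one
    term per time, and such errors can be summed only along countably many times; this is why open
    sets carry a countable set of times. The tool for removing unwanted coordinates is the supremum
    over them, [cyl_sup]: it stays in the class because sections of cylinder functions are totally
    bounded in the uniform norm. It serves twice: in [L_tight], to discharge one time after another,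
    and in [below_restrict], to replace a function below an open set by one that uses only the times
    of that set, so that approximants of past events depend on the past only. *)

(** The tails of [D], ordered by inclusion of the [A i], generate a filter, and compactness in its
    near-covering form applies to it. Coverage is asked only relative to [K], to suit functions that
    are continuous only along [K]. *)
Lemma compact_directed_cover (X : topologicalType) (I : Type) (K : set X)
    (D : set I) (A : I -> set X) :
  compact K -> D !=set0 ->
  (forall i j, D i -> D j ->
    exists2 k, D k & A i `<=` A k /\ A j `<=` A k) ->
  (forall x, K x -> exists2 i, D i & \forall y \near x, K y -> A i y) ->
  exists2 i, D i & K `<=` A i.
Proof.
move=> /compact_near_coveringP/near_covering_withinP cK [i0 Di0] dirD locD.
pose F : set_system I :=
  [set S | exists2 i, D i & forall k, D k -> A i `<=` A k -> S k].
have FF : Filter F.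
  split.
  - by exists i0.
  - move=> S S' [i Di iS] [j Dj jS']; have [k Dk [ik jk]] := dirD _ _ Di Dj.
    exists k => // l Dl kl; split.
    + by apply: iS => //; exact: subset_trans kl.
    + by apply: jS' => //; exact: subset_trans kl.
  - by move=> S S' SS' [i Di iS]; exists i => // k Dk ik; exact/SS'/iS.
have [|i Di iK] := cK I F (fun i x => A i x) FF.
  move=> x Kx; have [i Di iV] := locD x Kx.
  exists ([set y | K y -> A i y], [set k | D k /\ A i `<=` A k]) => /=.
    by split => //; exists i.
  by move=> [y k]/= [yi [Dk ik]] Ky; apply/ik/yi.
by exists i => //; apply: iK.
Qed.

(** * The space B^rho *)

Section weighted.
Context {R : realType} {E : ptopologicalType} (rho : E -> R).
Hypothesis rho_adm : admissible_weight rho.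

Let rho_gt0 x : 0 < rho x. Proof. by case: rho_adm. Qed.

Lemma rho_norm_leP (f : E -> R) (M : R) :
  (rho_norm rho f <= M%:E)%E <-> forall x, `|f x| <= M * rho x.
Proof.
split=> [fM x|fM].
  rewrite -ler_pdivrMr// -lee_fin (le_trans _ fM)//.
  by apply: ereal_sup_ubound; exists x.
apply: ge_ereal_sup => _ [x _ <-].
by rewrite lee_fin ler_pdivrMr.
Qed.

Lemma BrhoP (f : E -> R) : Brho rho f <->
  (exists M : R, forall x, `|f x| <= M * rho x) /\
  forall e : R, 0 < e ->
    exists2 g : E -> R, Cb g & forall x, `|f x - g x| <= e * rho x.
Proof.
split=> -[h1 h2]; split.
- have h0 : (0 <= rho_norm rho f)%E.
    apply: (@le_trans _ _ (`|f point| / rho point)%:E).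
      by rewrite lee_fin divr_ge0// ltW.
    by apply: ereal_sup_ubound; exists point.
  exists (fine (rho_norm rho f)); apply/rho_norm_leP.
  by rewrite fineK// ge0_fin_numE.
- move=> e /h2[g [cg ge]]; exists g => //.
  by apply/(rho_norm_leP (fun x => f x - g x)); exact: ltW.
- by case: h1 => M /rho_norm_leP fM; rewrite (le_lt_trans fM)// ltry.
- move=> e e0; have [|g cg ge] := h2 (e / 2); first by rewrite divr_gt0.
  exists g; split => //.
  have /rho_norm_leP/le_lt_trans := ge; apply.
  by rewrite lte_fin; lra.
Qed.

Lemma Cb_cst (a : R) : Cb (fun _ : E => a).
Proof. by split; [exact: cst_continuous|exists `|a| => x]. Qed.

Lemma CbD (f g : E -> R) : Cb f -> Cb g -> Cb (fun x => f x + g x).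
Proof.
move=> [cf [M fM]] [cg [N gN]]; split.
  by move=> x; apply: cvgD; [exact: cf|exact: cg].
by exists (M + N) => x; rewrite (le_trans (ler_normD _ _))// lerD.
Qed.

Lemma CbM (f g : E -> R) : Cb f -> Cb g -> Cb (fun x => f x * g x).
Proof.
move=> [cf [M fM]] [cg [N gN]]; split.
  by move=> x; apply: cvgM; [exact: cf|exact: cg].
by exists (M * N) => x; rewrite normrM ler_pM.
Qed.

Lemma Cb_norm (f : E -> R) : Cb f -> Cb (fun x => `|f x|).
Proof.
move=> [cf [M fM]]; split; first by move=> x; apply: cvg_norm; exact: cf.
by exists M => x; rewrite normr_id.
Qed.

Lemma Cb_max (f g : E -> R) : Cb f -> Cb g -> Cb (fun x => Num.max (f x) (g x)).
Proof.
move=> cf cg.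
have -> : (fun x => Num.max (f x) (g x)) =
          (fun x => 2^-1 * ((f x + g x) + `|f x + -1 * g x|)).
  by apply/funext => x; rewrite maxr_absE mulN1r; field.
exact: (CbM (Cb_cst _)
  (CbD (CbD cf cg) (Cb_norm (CbD cf (CbM (Cb_cst (-1)) cg))))).
Qed.

Lemma Brho_lin (a : R) f g :
  Brho rho f -> Brho rho g -> Brho rho (fun x => a * f x + g x).
Proof.
move=> /BrhoP[[M fM] f_] /BrhoP[[N gN] g_]; apply/BrhoP; split.
  exists (`|a| * M + N) => x.
  rewrite (le_trans (ler_normD _ _))// mulrDl lerD// normrM -mulrA.
  by rewrite ler_wpM2l.
move=> e e0.
have a1 : 0 < `|a| + 1 by rewrite ltr_wpDl.
have [|f' cf' ff'] := f_ (e / 2 / (`|a| + 1)); first by rewrite !divr_gt0.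
have [|g' cg' gg'] := g_ (e / 2); first by rewrite divr_gt0.
exists (fun x => a * f' x + g' x).
  by apply: CbD => //; apply: CbM => //; exact: Cb_cst.
move=> x; have -> : a * f x + g x - (a * f' x + g' x) =
  a * (f x - f' x) + (g x - g' x) by ring.
rewrite (le_trans (ler_normD _ _))//.
have -> : e * rho x = e / 2 * rho x + e / 2 * rho x by field.
rewrite lerD// normrM (le_trans (ler_wpM2l _ (ff' x)))//.
rewrite [leLHS](_ : _ = `|a| / (`|a| + 1) * (e / 2 * rho x)); last by field; lra.
rewrite ler_piMl ?mulr_ge0 ?divr_ge0// ?ltW//.
by rewrite ltr_pdivrMr// mul1r; lra.
Qed.

Lemma Brho_norm f : Brho rho f -> Brho rho (fun x => `|f x|).
Proof.
move=> /BrhoP[[M fM] f_]; apply/BrhoP; split.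
  by exists M => x; rewrite normr_id.
move=> e /f_[g cg fg]; exists (fun x => `|g x|); first exact: Cb_norm.
by move=> x; rewrite (le_trans (ler_dist_dist _ _)).
Qed.

Definition bBrho (f : E -> R) := Brho rho f /\ exists M : R, forall x, `|f x| <= M.

Hypothesis hE : hausdorff_space E.

Lemma rho_le_closed r : closed [set x | rho x <= r].
Proof.
have [r0|r0] := leP 0 r.
  by apply: compact_closed => //; case: rho_adm => _; exact.
rewrite (_ : [set _ | _] = set0); first exact: closed0.
by rewrite -subset0 => x/= /le_lt_trans/(_ r0); rewrite ltNge ltW.
Qed.

(** Sublevel sets are closed, so the sets where [rho] exceeds [1/(n+1)] form an increasing open
    cover of the compact set [rho <= 1]; off that set 1 is a bound. The constant [c] lets uniform
    approximation control the weighted norm. *)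
Lemma rho_ge_pos : exists2 c : R, 0 < c & forall x, c <= rho x.
Proof.
have [_ /(_ 1 ler01) cK] := rho_adm.
have [||x _|n _ Kn] := @compact_directed_cover E nat _ setT
    (fun n => [set x | n.+1%:R^-1 < rho x]) cK.
- by exists 0%N.
- move=> i j _ _; exists (maxn i j) => //; split => x/=; apply: le_lt_trans.
    by rewrite lef_pV2 ?posrE// ler_nat ltnS leq_maxl.
  by rewrite lef_pV2 ?posrE// ler_nat ltnS leq_maxr.
- exists (Num.truncn (rho x)^-1) => //.
  have rn : rho x > (Num.truncn (rho x)^-1).+1%:R^-1.
    rewrite -[ltRHS]invrK ltf_pV2 ?posrE ?invr_gt0//.
    by rewrite -truncn_le_nat.
  have : nbhs x (~` [set y | rho y <= (Num.truncn (rho x)^-1).+1%:R^-1]).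
    apply: open_nbhs_nbhs; split; first exact/closed_openC/rho_le_closed.
    by move=> /=; apply/negP; rewrite -ltNge.
  by apply: filterS => y /= /negP; rewrite -ltNge.
exists n.+1%:R^-1 => // x.
have [/Kn/ltW//|/ltW] := leP (rho x) 1.
by apply: le_trans; rewrite invf_le1// ler1n.
Qed.

Lemma bBrho_Cb f : Cb f -> bBrho f.
Proof.
move=> cf; split; last by case: cf.
have [c c0 rc] := rho_ge_pos.
apply/BrhoP; split.
  case: cf => _ [M fM]; exists (`|M| / c) => x.
  rewrite (le_trans (fM x))// (le_trans (ler_norm M))//.
  by rewrite mulrAC ler_pdivlMr// ler_wpM2l.
by move=> e e0; exists f => // x; rewrite subrr normr0 mulr_ge0// ltW.
Qed.

Lemma bBrho_cst (a : R) : bBrho (fun _ => a).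
Proof. exact/bBrho_Cb/Cb_cst. Qed.

Lemma bBrho_lin (a : R) f g : bBrho f -> bBrho g -> bBrho (fun x => a * f x + g x).
Proof.
move=> [Bf [M fM]] [Bg [N gN]]; split; first exact: Brho_lin.
exists (`|a| * M + N) => x.
by rewrite (le_trans (ler_normD _ _))// lerD// normrM ler_wpM2l.
Qed.

Lemma bBrhoD f g : bBrho f -> bBrho g -> bBrho (fun x => f x + g x).
Proof.
move=> bf bg; have := bBrho_lin 1 bf bg.
by congr bBrho; apply/funext => x; rewrite mul1r.
Qed.

Lemma bBrhoZ a f : bBrho f -> bBrho (fun x => a * f x).
Proof.
move=> bf; have := bBrho_lin a bf (bBrho_cst 0).
by congr bBrho; apply/funext => x; rewrite addr0.
Qed.

Lemma bBrhoM f g : bBrho f -> bBrho g -> bBrho (fun x => f x * g x).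
Proof.
move=> [Bf [M fM]] [Bg [N gN]].
have bfg : forall x, `|f x * g x| <= M * N by move=> x; rewrite normrM ler_pM.
split; last by exists (M * N).
have M0 : 0 <= M by apply: le_trans (fM point).
move: Bf Bg => /BrhoP[[M' fM'] f_] /BrhoP[[N' gN'] g_]; apply/BrhoP; split.
  exists (M * N') => x; rewrite normrM -mulrA ler_pM//.
move=> e e0.
(* [g'] is chosen first: its bound [L] is unrelated to [N] and fixes the accuracy required of [f'].
   The [+ 1] guards against a zero bound. *)
have [|g' cg' gg'] := g_ (e / 2 / (M + 1)); first by rewrite !divr_gt0//; lra.
have [_ [L g'L]] := cg'.
have L0 : 0 <= L by apply: le_trans (g'L point).
have [|f' cf' ff'] := f_ (e / 2 / (L + 1)); first by rewrite !divr_gt0//; lra.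
exists (fun x => f' x * g' x); first exact: CbM.
move=> x; have -> : f x * g x - f' x * g' x =
  f x * (g x - g' x) + g' x * (f x - f' x) by ring.
rewrite (le_trans (ler_normD _ _))// !normrM.
have -> : e * rho x = e / 2 * rho x + e / 2 * rho x by field.
have er : 0 <= e / 2 * rho x by rewrite mulr_ge0 ?divr_ge0// ltW.
rewrite lerD//.
- rewrite (le_trans (ler_pM _ _ (fM x) (gg' x)))//.
  rewrite [leLHS](_ : _ = M / (M + 1) * (e / 2 * rho x)); last by field; lra.
  by rewrite ler_piMl// ler_pdivrMr ?mul1r; lra.
- rewrite (le_trans (ler_pM _ _ (g'L x) (ff' x)))//.
  rewrite [leLHS](_ : _ = L / (L + 1) * (e / 2 * rho x)); last by field; lra.
  by rewrite ler_piMl// ler_pdivrMr ?mul1r; lra.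
Qed.

(** A uniform error [e / 2 * c] is at most [e / 2 * rho x], since [c] bounds [rho] from below. *)
Lemma bBrho_lim f :
  (forall e : R, 0 < e -> exists2 g, bBrho g & forall x, `|f x - g x| <= e) -> bBrho f.
Proof.
move=> f_; have [c c0 rc] := rho_ge_pos.
split; last first.
  have [g [_ [M gM]] fg] := f_ 1 ltr01; exists (1 + M) => x.
  by rewrite -[f x](subrK (g x)) (le_trans (ler_normD _ _))// lerD.
have [g [/BrhoP[[M gM] _] _] fg] := f_ c c0.
apply/BrhoP; split.
  exists (1 + M) => x.
  rewrite -[f x](subrK (g x)) (le_trans (ler_normD _ _))// mulrDl lerD//.
  by rewrite mul1r (le_trans (fg x)).
move=> e e0; have [|h [/BrhoP[_ h_] _] fh] := f_ (e / 2 * c).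
  by rewrite mulr_gt0// divr_gt0.
have [|k ck hk] := h_ (e / 2); first by rewrite divr_gt0.
exists k => // x.
have -> : f x - k x = (f x - h x) + (h x - k x) by ring.
have -> : e * rho x = e / 2 * rho x + e / 2 * rho x by field.
rewrite (le_trans (ler_normD _ _))// lerD// (le_trans (fh x))//.
by rewrite ler_pM2l// divr_gt0.
Qed.

(** On [rho <= r] a weighted error [e / 4 / r] is a uniform error [e / 4], so [f] is there a uniform
    limit of continuous functions. Nothing is claimed at nearby points where [rho] exceeds [r]. *)
Lemma bBrho_continuous_sublevel f r x e : bBrho f -> rho x <= r -> 0 < e ->
  \forall y \near x, rho y <= r -> `|f y - f x| < e.
Proof.
move=> [/BrhoP[_ f_] _] xr e0.
have r0 : 0 < r by apply: lt_le_trans xr.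
have [|g [cg _] fg] := f_ (e / 4 / r); first by rewrite !divr_gt0.
have fgr y : rho y <= r -> `|f y - g y| <= e / 4.
  move=> yr; rewrite (le_trans (fg y))// -ler_pdivlMr// ler_pM2l ?divr_gt0//.
  by rewrite lef_pV2 ?posrE.
have := cg x; move/cvgrPdist_lt => /(_ (e / 4)).
rewrite divr_gt0// => /(_ isT); apply: filterS => y gxy yr.
have -> : f y - f x = (f y - g y) - (f x - g x) - (g x - g y) by ring.
rewrite (le_lt_trans (ler_normB _ _))//.
have := ler_normB (f y - g y) (f x - g x).
have := fgr _ yr; have := fgr _ xr; lra.
Qed.

End weighted.

(** * The semigroup: sup-norm contraction, weighted bound, measurability *)

Section feller.
Context {R : realType} {E : ptopologicalType} (rho : E -> R).
Hypothesis rho_adm : admissible_weight rho.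
Hypothesis hE : hausdorff_space E.
Variable P : R -> (E -> R) -> (E -> R).
Hypothesis fP : generalized_Feller rho P.
Hypothesis P1 : forall t : R, 0 <= t -> P t (fun _ => 1) = (fun _ => 1).

Lemma feller_lin (t a : R) f g : 0 <= t -> Brho rho f -> Brho rho g ->
  P t (fun x => a * f x + g x) = (fun x => a * P t f x + P t g x).
Proof. by move=> t0 bf bg; case: fP => /(_ t t0) [_ [+ _]] _; exact. Qed.

Lemma feller_Brho (t : R) f : 0 <= t -> Brho rho f -> Brho rho (P t f).
Proof. by move=> t0 bf; case: fP => /(_ t t0) [+ _] _; exact. Qed.

Lemma feller_ge0 (t : R) f : 0 <= t -> Brho rho f -> (forall x, 0 <= f x) ->
  forall x, 0 <= P t f x.
Proof. by case: fP => _ [_ [_ [_ [_ h]]]]; exact: h. Qed.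

Lemma feller0 f : Brho rho f -> P 0 f = f.
Proof. by case: fP => _ [h _]; exact: h. Qed.

Lemma fellerD (s t : R) f : 0 <= s -> 0 <= t -> Brho rho f ->
  P (t + s) f = P s (P t f).
Proof. by case: fP => _ [_ [h _]]; exact: h. Qed.

Lemma feller_cvg f x : Brho rho f -> (fun t => P t f x) @ 0^'+ --> f x.
Proof. by case: fP => _ [_ [_ [h _]]]; exact: h. Qed.

Lemma feller_cst (t a : R) : 0 <= t -> P t (fun _ => a) = (fun _ => a).
Proof.
move=> t0; have B1 b : Brho rho (fun=> b) by case: (bBrho_cst rho_adm hE b).
(* Linearity is available in the form [a * f + g], hence the splitting [a = (a - 1) * 1 + 1]. *)
have := @feller_lin t (a - 1) _ _ t0 (B1 1) (B1 1).
rewrite P1// (_ : (fun x => (a - 1) * 1 + 1) = (fun=> a)) // -?[RHS]/(fun=> _).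
by apply/funext => x; lra.
Qed.

Lemma feller_le (t : R) f g : 0 <= t -> Brho rho f -> Brho rho g ->
  (forall x, f x <= g x) -> forall x, P t f x <= P t g x.
Proof.
move=> t0 bf bg fg x; rewrite -subr_ge0.
have -> : P t g x - P t f x = P t (fun x => -1 * f x + g x) x.
  by rewrite feller_lin//; lra.
apply: feller_ge0 => // [|y]; first exact: Brho_lin.
by rewrite mulN1r addrC subr_ge0.
Qed.

(** Positivity and [P t 1 = 1] give a sup-norm contraction, with constant 1 for every [t]; the
    operator bound speaks of the weighted norm only. *)
Lemma feller_norm (t : R) f (M : R) : 0 <= t -> Brho rho f -> (forall x, `|f x| <= M) ->
  forall x, `|P t f x| <= M.
Proof.
move=> t0 bf fM x; rewrite ler_norml.
have B1 b : Brho rho (fun=> b) by case: (bBrho_cst rho_adm hE b).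
have -> : (- M <= P t f x <= M) =
    (P t (fun=> - M) x <= P t f x <= P t (fun=> M) x) by rewrite !feller_cst.
by apply/andP; split; apply: feller_le => // y;
  have := fM y; rewrite ler_norml => /andP[].
Qed.

Lemma feller_bBrho (t : R) f : 0 <= t -> bBrho rho f -> bBrho rho (P t f).
Proof.
move=> t0 [bf [M fM]]; split; first exact: feller_Brho.
by exists M; exact: feller_norm.
Qed.

(** Pointwise form of the operator bound. It feeds both tightness and the passage to unbounded
    functions. *)
Lemma feller_rho (t : R) : 0 <= t -> exists2 C : R, 0 <= C &
  forall f (M : R), Brho rho f -> (forall x, `|f x| <= M * rho x) ->
  forall x, `|P t f x| <= C * M * rho x.
Proof.
move=> t0; case: fP => /(_ t t0)[_ [_ [C PC]]] _.
exists `|C| => // f M bf fM; apply/rho_norm_leP => //.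
rewrite (le_trans (PC f bf))// EFinM.
have n0 : (0 <= rho_norm rho f)%E.
  apply: (@le_trans _ _ (`|f point| / rho point)%:E).
    by rewrite lee_fin divr_ge0// ltW//; case: rho_adm.
  by apply: ereal_sup_ubound; exists point.
apply: (@le_trans _ _ (`|C|%:E * rho_norm rho f)%E).
  by rewrite lee_wpmul2r// lee_fin ler_norm.
by rewrite lee_wpmul2l ?lee_fin//; exact/rho_norm_leP.
Qed.

Lemma lsc_Borel_measurable (f : E -> R) :
  (forall r, open [set x | r < f x]) -> measurable_fun setT (f : Borel E -> R).
Proof.
move=> of_; apply: (measurability _ (RGenOInfty.measurableE R)).
move=> _ [_ [r ->] <-]; rewrite setTI.
have -> : f @^-1` `]r, +oo[%classic = [set x | r < f x].
  by apply/seteqP; split => x /=; rewrite in_itv/= andbT.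
exact: sub_sigma_algebra (of_ r).
Qed.

Lemma rho_measurable : measurable_fun setT (rho : Borel E -> R).
Proof.
apply: lsc_Borel_measurable => r.
rewrite (_ : [set _ | _] = ~` [set x | rho x <= r]).
  exact/closed_openC/rho_le_closed.
by apply/seteqP; split => x /=; rewrite ltNge => /negP.
Qed.

(** Continuous approximants with weighted error [1/(n+1)] converge pointwise, not necessarily
    uniformly; a pointwise limit is enough for measurability. *)
Lemma Brho_measurable f : Brho rho f -> measurable_fun setT (f : Borel E -> R).
Proof.
move=> /(BrhoP rho_adm)[_ f_].
have /choice[g gP] : forall n : nat, exists g : E -> R, Cb g /\
    forall x, `|f x - g x| <= n.+1%:R^-1 * rho x.
  by move=> n; have [|g cg fg] := f_ n.+1%:R^-1; [|exists g].
apply: (@measurable_fun_cvg _ (Borel E) _ setT g) => [n|x _].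
  apply: lsc_Borel_measurable => r.
  have [[/continuousP + _] _] := gP n.
  move=> /(_ [set y | r < y] (@open_gt R r)); exact.
apply/cvgrPdist_le => e e0.
have r0 : 0 < rho x by case: rho_adm.
near=> n.
have [_ /(_ x)/le_trans] := gP n; apply.
rewrite -ler_pdivlMr// -[leRHS]invrK lef_pV2 ?posrE ?invr_gt0 ?divr_gt0//.
rewrite ltW//; near: n.
exists (Num.truncn (e / rho x)^-1) => // n /= hn.
by rewrite -truncn_le_nat.
Unshelve. all: by end_near. Qed.

End feller.

(** * Cylinder functions *)

Section abs_approx.
Context {R : realType}.

(* The classical polynomial iteration converging uniformly to [`|x|] on [-1, 1]. *)
Fixpoint abs_approx (x : R) (k : nat) : R :=
  if k is k'.+1 then
    let p := abs_approx x k' in p + 2^-1 * (x * x + -1 * (p * p))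
  else 0.

(** With [a = |x|] and [p] the current iterate, each step multiplies the error by [1 - (a + p) / 2],
    at most [1 - a / 2]. Hence [(a - p) * (1 + n * (a / 2)) <= a] persists, and it gives a rate
    uniform in [x], however small [a] is. *)
Lemma abs_approx_cvg (x : R) k : `|x| <= 1 ->
  `| `|x| - abs_approx x k.+1| <= 2 / k.+1%:R.
Proof.
move=> x1; set a := `|x|.
have a0 : 0 <= a by rewrite normr_ge0.
have a1 : a <= 1 by [].
have xx : x * x = a * a by rewrite -!expr2 /a real_normK// num_real.
have inv n : [/\ 0 <= abs_approx x n, abs_approx x n <= a &
    (a - abs_approx x n) * (1 + n%:R * (a / 2)) <= a].
  elim: n => [|n [p0 pa dn]] /=; first by split => //; lra.
  set p := abs_approx x n in p0 pa dn *.
  have n0 : 0 <= n%:R :> R by [].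
  have pa2 : 0 <= a * a - p * p by nra.
  rewrite xx; split; first by nra.
    by have : 0 <= (a - p) * (2 - (a + p)); [apply: mulr_ge0; lra|lra].
  have -> : (a - (p + 2^-1 * (a * a + -1 * (p * p)))) =
    (a - p) * (1 - (a + p) / 2) by field.
  apply: le_trans dn; rewrite -mulrA; apply: ler_wpM2l; first by lra.
  rewrite -[n.+1%:R]natr1; set m := n%:R.
  have h : (1 - (a + p) / 2) * (1 + (m + 1) * (a / 2)) <=
           (1 - a / 2) * (1 + (m + 1) * (a / 2)).
    apply: ler_wpM2r; last by lra.
    by rewrite addr_ge0// mulr_ge0//; rewrite /m; lra.
  apply: (le_trans h).
  have -> : (1 - a / 2) * (1 + (m + 1) * (a / 2)) =
     1 + m * (a / 2) - (m + 1) * (a / 2) * (a / 2) by field.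
  by rewrite gerBl !mulr_ge0//; rewrite /m; lra.
have [p0 pa dn] := inv k.+1.
set p := abs_approx x k.+1 in p0 pa dn *.
rewrite ger0_norm ?subr_ge0// ler_pdivlMr//.
have [a_eq0|an0] := eqVneq a 0.
  by rewrite (_ : a - p = 0) ?mul0r//; lra.
have ap : 0 < a by rewrite lt_neqAle eq_sym an0.
rewrite -(ler_pM2r (_ : 0 < a / 2)); last by lra.
have -> : 2 * (a / 2) = a by field.
apply: le_trans dn; rewrite mulrDr mulr1 mulrA lerDr; lra.
Qed.

End abs_approx.

Section cylinder_functions.
Context {R : realType} {E : ptopologicalType} {T : eqType} (rho : E -> R).
Hypothesis rho_adm : admissible_weight rho.
Hypothesis hE : hausdorff_space E.
Let X := T -> E.
Implicit Types (F G : seq T) (Phi Psi : X -> R) (w z : X).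

(** Coordinate factors are multiplied on one at a time, so that each induction treats a single
    [f (w t)]; products come later in [cylM]. Uniform limits use an explicit sequence and rate,
    which gives an induction hypothesis for each approximant. *)
Inductive cyl F : (X -> R) -> Prop :=
| cyl_cst a : cyl F (fun _ => a)
| cyl_coord t f Phi : t \in F -> bBrho rho f -> cyl F Phi ->
    cyl F (fun w => f (w t) * Phi w)
| cylD Phi Psi : cyl F Phi -> cyl F Psi -> cyl F (fun w => Phi w + Psi w)
| cyl_lim_seq Phi (Psi_ : nat -> X -> R) : (forall n, cyl F (Psi_ n)) ->
    (forall n w, `|Phi w - Psi_ n w| <= n.+1%:R^-1) -> cyl F Phi.

Lemma cyl_lim F Phi :
  (forall e : R, 0 < e -> exists2 Psi, cyl F Psi & forall w, `|Phi w - Psi w| <= e) ->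
  cyl F Phi.
Proof.
move=> h; have /choice[Psi_ PsiP] : forall n : nat, exists Psi, cyl F Psi /\
    forall w, `|Phi w - Psi w| <= n.+1%:R^-1.
  by move=> n; have [|Psi ? ?] := h n.+1%:R^-1; [|exists Psi].
by apply: (@cyl_lim_seq _ _ Psi_) => n; case: (PsiP n).
Qed.

Lemma cyl_ext F Phi Psi : Phi =1 Psi -> cyl F Phi -> cyl F Psi.
Proof. by move=> /funext ->. Qed.

Lemma cyl_sub F G Phi : {subset F <= G} -> cyl F Phi -> cyl G Phi.
Proof.
move=> FG; elim=> {Phi}.
- exact: cyl_cst.
- by move=> t f Phi tF bf _ ih; apply: cyl_coord => //; exact: FG.
- by move=> Phi Psi _ ? _ ?; exact: cylD.
- by move=> Phi Psi_ _ ih h; exact: cyl_lim_seq ih h.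
Qed.

Lemma cyl_bounded F Phi : cyl F Phi -> exists M : R, forall w, `|Phi w| <= M.
Proof.
elim=> {Phi}.
- by move=> a; exists `|a|.
- move=> t f Phi _ [_ [M fM]] _ [N PN]; exists (M * N) => w.
  by rewrite normrM ler_pM.
- move=> Phi Psi _ [M PM] _ [N PN]; exists (M + N) => w.
  by rewrite (le_trans (ler_normD _ _))// lerD.
- move=> Phi Psi_ _ ih h; have [M PM] := ih 0%N; exists (1 + M) => w.
  rewrite -[Phi w](subrK (Psi_ 0%N w)) (le_trans (ler_normD _ _))// lerD//.
  by have := h 0%N w; rewrite invr1.
Qed.

Lemma cylZ F a Phi : cyl F Phi -> cyl F (fun w => a * Phi w).
Proof.
elim=> {Phi}.
- by move=> b; exact: cyl_cst.
- move=> t f Phi tF bf _ /(cyl_coord tF bf); apply: cyl_ext => w; ring.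
- by move=> Phi Psi _ h _ k; apply: cyl_ext (cylD h k) => w; ring.
- move=> Phi Psi_ _ ih h; apply: cyl_lim => e e0.
  have a1 : 0 < `|a| + 1 by rewrite ltr_wpDl.
  pose n := Num.truncn ((`|a| + 1) / e).
  exists (fun w => a * Psi_ n w); first exact: ih.
  move=> w; rewrite -mulrBr normrM.
  apply: (@le_trans _ _ ((`|a| + 1) * n.+1%:R^-1)); first by rewrite ler_pM// lerDl.
  rewrite ler_pdivrMr// mulrC -ler_pdivrMr// ltW//.
  by rewrite -truncn_le_nat.
Qed.

Lemma cylB F Phi Psi : cyl F Phi -> cyl F Psi -> cyl F (fun w => Phi w - Psi w).
Proof.
move=> h k; apply: cyl_ext (cylD h (cylZ (-1) k)) => w; ring.
Qed.

Lemma cylM F Phi Psi : cyl F Phi -> cyl F Psi -> cyl F (fun w => Phi w * Psi w).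
Proof.
move=> + cP; have [N PN] := cyl_bounded cP; elim=> {Phi}.
- by move=> a; exact: cylZ.
- by move=> t f Phi tF bf _ /(cyl_coord tF bf); apply: cyl_ext => w; ring.
- by move=> Phi Psi' _ h _ k; apply: cyl_ext (cylD h k) => w; ring.
- move=> Phi Psi_ _ ih h; apply: cyl_lim => e e0.
  have N1 : 0 < N + 1 by rewrite ltr_wpDl//; exact: le_trans (PN (fun=> point)).
  pose n := Num.truncn ((N + 1) / e).
  exists (fun w => Psi_ n w * Psi w); first exact: ih.
  move=> w; rewrite -mulrBl normrM mulrC.
  apply: (@le_trans _ _ ((N + 1) * n.+1%:R^-1)).
    by rewrite ler_pM// (le_trans (PN _))// lerDl.
  rewrite ler_pdivrMr// mulrC -ler_pdivrMr// ltW//.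
  by rewrite -truncn_le_nat.
Qed.

(** After rescaling into [[-1, 1]], the polynomials [abs_approx] in [Psi] stay in the algebra and
    converge uniformly to [|Psi|]. The lattice operations follow. *)
Lemma cyl_norm F Phi : cyl F Phi -> cyl F (fun w => `|Phi w|).
Proof.
move=> cP; have [M PM] := cyl_bounded cP.
have M0 : 0 <= M by exact: le_trans (PM (fun=> point)).
have M1 : 0 < M + 1 by lra.
pose Psi w := (M + 1)^-1 * Phi w.
have cPsi : cyl F Psi by exact: cylZ.
have Psi1 w : `|Psi w| <= 1.
  rewrite /Psi normrM gtr0_norm ?invr_gt0// mulrC ler_pdivrMr// mul1r.
  by rewrite (le_trans (PM w))// lerDl.
suff : cyl F (fun w => `|Psi w|).
  move=> /(cylZ (M + 1)); apply: cyl_ext => w.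
  rewrite /Psi normrM (ger0_norm (ltW _)) ?invr_gt0// mulrA divff ?mul1r//.
  by rewrite gt_eqF.
apply: cyl_lim => e e0.
pose n := Num.truncn (2 / e).
exists (fun w => abs_approx (Psi w) n.+1).
  elim: n.+1 => [|k ih] /=; first exact: cyl_cst.
  by apply: cylD => //; apply/cylZ/cylD; [|apply: cylZ]; exact: cylM.
move=> w; rewrite (le_trans (abs_approx_cvg n (Psi1 w)))//.
rewrite ler_pdivrMr// mulrC -ler_pdivrMr// ltW//.
by rewrite -truncn_le_nat.
Qed.

Lemma cyl_max F Phi Psi : cyl F Phi -> cyl F Psi ->
  cyl F (fun w => Num.max (Phi w) (Psi w)).
Proof.
move=> h k; apply: cyl_ext (cylZ 2^-1 (cylD (cylD h k) (cyl_norm (cylB h k)))).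
by move=> w /=; rewrite maxr_absE; field.
Qed.

Lemma cyl_min F Phi Psi : cyl F Phi -> cyl F Psi ->
  cyl F (fun w => Num.min (Phi w) (Psi w)).
Proof.
move=> h k; apply: cyl_ext (cylZ 2^-1 (cylB (cylD h k) (cyl_norm (cylB h k)))).
by move=> w /=; rewrite minr_absE; field.
Qed.

Lemma cyl_eq F Phi w w' : cyl F Phi -> {in F, w =1 w'} -> Phi w = Phi w'.
Proof.
move=> + ww'; elim=> {Phi}.
- by [].
- by move=> t f Phi /ww' -> _ _ ->.
- by move=> Phi Psi _ -> _ ->.
- move=> Phi Psi_ _ ih h; apply/eqP; rewrite -subr_eq0 -normr_eq0.
  apply/eqP/le_anti; rewrite normr_ge0 andbT; apply/ler_addgt0Pr => e e0.
  pose n := Num.truncn (2 / e).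
  have -> : Phi w - Phi w' = (Phi w - Psi_ n w) - (Phi w' - Psi_ n w').
    by rewrite (ih n); ring.
  rewrite add0r (le_trans (ler_normB _ _))// (le_trans (lerD (h n w) (h n w')))//.
  rewrite -[leLHS]mulr2n -[leLHS]mulr_natl ler_pdivrMr// mulrC -ler_pdivrMr// ltW//.
  by rewrite -truncn_le_nat.
Qed.

Definition splice (J : pred T) w z : X := fun t => if J t then w t else z t.

Lemma cyl_splice F J z Phi : cyl F Phi ->
  cyl [seq t <- F | J t] (fun w => Phi (splice J w z)).
Proof.
elim=> {Phi}.
- by move=> a; exact: cyl_cst.
- move=> t f Phi tF bf _ ih; have [Jt|Jt] := boolP (J t).
    have tF' : t \in [seq t <- F | J t] by rewrite mem_filter Jt.
    by apply: cyl_ext (cyl_coord tF' bf ih) => w; rewrite /splice Jt.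
  by apply: cyl_ext (cylZ (f (z t)) ih) => w; rewrite {2}/splice (negbTE Jt).
- by move=> Phi Psi _ h _ k; exact: cylD h k.
- by move=> Phi Psi_ _ ih h; exact: cyl_lim_seq ih (fun n w => h n _).
Qed.

(** The times in [J] all receive the same value [y]. With [J = pred1 t] this is a section in one
    variable, to which [P] applies; with [J = xpredT] it is the diagonal, which is integrated
    against [nu]. *)
Lemma cyl_bBrho F J w Phi : cyl F Phi ->
  bBrho rho (fun y => Phi (splice J (fun=> y) w)).
Proof.
elim=> {Phi}.
- by move=> a; exact: bBrho_cst.
- move=> t f Phi tF bf _ ih; have [Jt|Jt] := boolP (J t).
    have := bBrhoM rho_adm bf ih.
    by congr bBrho; apply/funext => y; rewrite {2}/splice Jt.
  have := bBrhoZ rho_adm hE (f (w t)) ih.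
  by congr bBrho; apply/funext => y; rewrite {2}/splice (negbTE Jt).
- by move=> Phi Psi _ h _ k; exact: (bBrhoD rho_adm h k).
- move=> Phi Psi_ _ ih h; apply: bBrho_lim => // e e0.
  pose n := Num.truncn e^-1.
  exists (fun y => Psi_ n (splice J (fun=> y) w)) => // y.
  rewrite (le_trans (h n _))// -[leRHS]invrK lef_pV2 ?posrE ?invr_gt0// ltW//.
  by rewrite -truncn_le_nat.
Qed.

(* Total boundedness, in the uniform norm, of the sections of [Phi] obtained by
   freezing the coordinates outside [J]; the colouring form is stable under sums
   and products. *)
Lemma cyl_colouring F J Phi (e : R) : cyl F Phi -> 0 < e ->
  exists (C : finType) (c : X -> C), forall z z', c z = c z' ->
    forall w, `|Phi (splice J w z) - Phi (splice J w z')| <= e.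
Proof.
move=> cP; elim: cP e => {Phi}.
- move=> a e e0; exists unit, (fun=> tt) => z z' _ w.
  by rewrite subrr normr0 ltW.
- move=> t f Phi tF [bf [M fM]] cP ih e e0.
  have M0 : 0 <= M by exact: le_trans (fM point).
  have M1 : 0 < M + 1 by lra.
  have [N PN] := cyl_bounded cP.
  have N0 : 0 <= N by exact: le_trans (PN (fun=> point)).
  have N1 : 0 < N + 1 by lra.
  have [|C [c cP']] := ih (e / 2 / (M + 1)); first by rewrite !divr_gt0.
  pose d := e / 2 / (N + 1); have d0 : 0 < d by rewrite !divr_gt0.
  (* Cells of mesh [d] partition the range [[-M, M]] of [f], and [m z] is the cell of [f (z t)]:
     equal colours force the two values within [d]. The bound [mlt] makes the palette finite. *)
  pose m z := Num.truncn ((f (z t) + M) / d).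
  have fM0 z : 0 <= (f (z t) + M) / d.
    apply: divr_ge0; last exact: ltW.
    by have := fM (z t); rewrite ler_norml; lra.
  have mlt z : (m z < (Num.truncn ((M + M) / d)).+1)%N.
    rewrite ltnS; apply: le_truncn; rewrite ler_pM2r ?invr_gt0//.
    by have := fM (z t); rewrite ler_norml; lra.
  exists (C * 'I_(Num.truncn ((M + M) / d)).+1)%type,
    (fun z => (c z, Ordinal (mlt z))) => z z' [cz mz] w.
  have IH := cP' _ _ cz w.
  have fz : `|f (splice J w z t) - f (splice J w z' t)| <= d.
    rewrite /splice; case: ifPn => _; first by rewrite subrr normr0 ltW.
    have /andP[l1 u1] := truncn_itv (fM0 z).
    have /andP[l2 u2] := truncn_itv (fM0 z').
    move: u1 l1; rewrite -/(m z) mz /m => u1 l1.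
    have h : `|(f (z t) + M) / d - (f (z' t) + M) / d| <= 1.
      by move: l1 l2 u1 u2; rewrite -!natr1 ler_norml; lra.
    have dV : 0 < d^-1 by rewrite invr_gt0.
    move: h; rewrite -mulrBl normrM (gtr0_norm dV).
    by rewrite ler_pdivrMr// mul1r; congr (`|_| <= _); ring.
  set a := f _ in fz *; set a' := f _ in fz *.
  set b := Phi _ in IH *; set b' := Phi _ in IH *.
  have -> : a * b - a' * b' = (a - a') * b + a' * (b - b') by ring.
  rewrite (le_trans (ler_normD _ _))// !normrM.
  have h1 : `|a - a'| * `|b| <= e / 2.
    apply: (@le_trans _ _ (d * (N + 1))); last by rewrite /d divfK// gt_eqF.
    by rewrite ler_pM// (le_trans (PN _))// lerDl.
  have h2 : `|a'| * `|b - b'| <= e / 2.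
    apply: (@le_trans _ _ ((M + 1) * (e / 2 / (M + 1)))).
      by rewrite ler_pM// (le_trans (fM _))// lerDl.
    by rewrite mulrC divfK// gt_eqF.
  by have := lerD h1 h2; lra.
- move=> Phi Psi _ ih1 _ ih2 e e0.
  have e2 : 0 < e / 2 by rewrite divr_gt0.
  have [C [c h1]] := ih1 _ e2; have [D [d h2]] := ih2 _ e2.
  exists (C * D)%type, (fun z => (c z, d z)) => z z' [cz dz] w.
  have := lerD (h1 _ _ cz w) (h2 _ _ dz w).
  set a := Phi _; set b := Phi _; set a' := Psi _; set b' := Psi _ => h.
  have -> : a + a' - (b + b') = (a - b) + (a' - b') by ring.
  by rewrite (le_trans (ler_normD _ _))//; lra.
- move=> Phi Psi_ _ ih h e e0.
  have e3 : 0 < e / 3 by rewrite divr_gt0.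
  pose n := Num.truncn (e / 3)^-1.
  have nP : n.+1%:R^-1 <= e / 3.
    rewrite -[leRHS]invrK lef_pV2 ?posrE ?invr_gt0// ltW//.
    by rewrite -truncn_le_nat.
  have [C [c hc]] := ih n _ e3; exists C, c => z z' cz w.
  have := hc _ _ cz w; have := h n (splice J w z); have := h n (splice J w z').
  set a := Phi _; set b := Phi _; set a' := Psi_ _ _; set b' := Psi_ _ _.
  move=> /le_trans/(_ nP) h1 /le_trans/(_ nP) h2 h3.
  have -> : b - a = (b - b') - (a - a') + (b' - a') by ring.
  rewrite (le_trans (ler_normD _ _))// (le_trans (lerD (ler_normB _ _) (lexx _)))//.
  rewrite (le_trans (lerD (lerD h2 h1) h3))//; lra.
Qed.

Lemma cyl_bigmax F (I : Type) (r : seq I) (Phi_ : I -> X -> R) Psi :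
  cyl F Psi -> (forall i, cyl F (Phi_ i)) ->
  cyl F (fun w => \big[Num.max/Psi w]_(i <- r) Phi_ i w).
Proof.
move=> cPsi cP; elim: r => [|i r ih].
  by apply: cyl_ext cPsi => w; rewrite big_nil.
by apply: cyl_ext (cyl_max (cP i) ih) => w; rewrite big_cons.
Qed.

Lemma cyl_sup F J Phi (Z : set X) : cyl F Phi -> Z !=set0 ->
  cyl [seq t <- F | J t] (fun w => sup [set Phi (splice J w z) | z in Z]).
Proof.
move=> cP [z0 Zz0]; apply: cyl_lim => e e0.
have [C [c hc]] := cyl_colouring J cP e0.
have [M PM] := cyl_bounded cP.
(* A colour absent from [Z] gets the default [z0], still in [Z], so the maximum never exceeds the
   supremum. *)
pose r (i : C) : X := xget z0 [set z | Z z /\ c z = i].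
have Zr i : Z (r i) by rewrite /r; case: xgetP => [z _ []|].
have cr z : Z z -> c (r (c z)) = c z.
  move=> Zz; rewrite /r; case: xgetP => [z' _ []//|/(_ z)].
  by move=> /not_andP[].
pose g w := \big[Num.max/Phi (splice J w z0)]_(i : C) Phi (splice J w (r i)).
exists g; first by apply: cyl_bigmax => [|i]; exact: cyl_splice.
move=> w; set S := [set _ | _ in _].
have S_ub : has_ubound S.
  by exists M => _ [z Zz <-]; rewrite (le_trans _ (PM (splice J w z)))// ler_norm.
have S0 : S !=set0 by exists (Phi (splice J w z0)), z0.
have gS : g w <= sup S.
  apply: bigmax_le => [|i _]; apply: ub_le_sup => //; first by exists z0.
  by exists (r i).
rewrite ger0_norm ?subr_ge0// lerBlDr; apply: ge_sup => // _ [z Zz <-].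
have := hc _ _ (cr z Zz) w; rewrite distrC => /(le_trans (ler_norm _)).
rewrite lerBlDr => /le_trans; apply; rewrite lerD2l.
exact: (le_bigmax _ (fun i => Phi (splice J w (r i)))).
Qed.

End cylinder_functions.

(** * The functional on cylinder functions *)

Lemma bounded_integrable {R : realType} (d : measure_display) (T : measurableType d)
    (Q : probability T R) (g : T -> R) (M : R) :
  measurable_fun setT g -> (forall x, `|g x| <= M) ->
  Q.-integrable setT (EFin \o g).
Proof.
move=> mg gM.
apply: (@le_integrable _ _ _ _ _ _ _ (cst M%:E)) => //.
- exact/measurable_EFinP.
- by move=> x _ /=; rewrite lee_fin (le_trans (gM x))// ler_norm.
- exact: finite_measure_integrable_cst.
Qed.

Section finite_dimensional.
Context {R : realType} {E : ptopologicalType} (rho : E -> R).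
Hypothesis rho_adm : admissible_weight rho.
Hypothesis hE : hausdorff_space E.
Variable P : R -> (E -> R) -> (E -> R).
Hypothesis fP : generalized_Feller rho P.
Hypothesis P1 : forall t : R, 0 <= t -> P t (fun _ => 1) = (fun _ => 1).
Variable nu : probability (Borel E) R.

Local Notation T := {nonneg R}.
Local Notation X := (T -> E).
Local Notation cyl := (cyl (T := T) rho).
Implicit Types (F G : seq T) (Phi Psi : X -> R) (w z : X) (s t u : T).

Definition leT s t : bool := s%:num <= t%:num.

Lemma leT_trans : transitive leT.
Proof. by move=> t s u; exact: le_trans. Qed.

Lemma leT_total : total leT.
Proof. by move=> s t; exact: le_total. Qed.

Lemma leT_anti : antisymmetric leT.
Proof. by move=> s t /le_anti h; exact/val_inj. Qed.

Lemma leT0 s : leT 0%:nng s.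
Proof. by rewrite /leT /=. Qed.

Definition upd w t (y : E) : X := splice (pred1 t) (fun=> y) w.

(** A transition from time [s] acting on the coordinate [t]: [Phi] is averaged over its value at
    [t], given the position [w s]. *)
Definition step s t Phi : X -> R :=
  fun w => P (t%:num - s%:num) (fun y => Phi (upd w t y)) (w s).

Fixpoint steps s F Phi : X -> R :=
  if F is t :: F' then step s t (steps t F' Phi) else Phi.

Lemma cyl_step F G s t Phi : leT s t -> s \in G ->
  {subset [seq u <- F | u != t] <= G} -> cyl F Phi -> cyl G (step s t Phi).
Proof.
move=> st sG FG cP.
have d0 : 0 <= t%:num - s%:num by rewrite subr_ge0.
(* The multiplier [g] collects the factors at time [t] met during the induction, which cannot be
   taken out of [P]; a factor at another time is constant in [y] and comes out by linearity. *)
suff h g : bBrho rho g -> cyl G (fun w =>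
    P (t%:num - s%:num) (fun y => g y * Phi (upd w t y)) (w s)).
  apply: cyl_ext (h _ (bBrho_cst rho_adm hE 1)) => w.
  by rewrite /step; congr (P _ _ _); apply/funext => y; rewrite mul1r.
elim: cP g => {Phi}.
- move=> a g bg.
  have bga : bBrho rho (fun y => g y * a).
    exact: (bBrhoM rho_adm bg (bBrho_cst rho_adm hE a)).
  have := cyl_coord sG (feller_bBrho rho_adm hE fP P1 d0 bga) (cyl_cst rho G 1).
  by apply: cyl_ext => w; rewrite mulr1.
- move=> u f Phi uF bf cP ih g bg; have [ut|ut] := eqVneq u t.
    apply: cyl_ext (ih _ (bBrhoM rho_adm bg bf)) => w.
    congr (P _ _ _); apply/funext => y.
    by rewrite /upd {2}/splice /= ut eqxx mulrA.
  have uG : u \in G by apply: FG; rewrite mem_filter ut.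
  apply: cyl_ext (cyl_coord uG bf (ih _ bg)) => w.
  have [bgP _] := bBrhoM rho_adm bg (cyl_bBrho rho_adm hE (pred1 t) w cP).
  have [b0 _] := bBrho_cst rho_adm hE 0.
  have := feller_lin fP (f (w u)) d0 bgP b0.
  rewrite (feller_cst rho_adm hE fP P1 _ d0) => /(congr1 (fun h => h (w s))).
  rewrite addr0 => <-; congr (P _ _ _); apply/funext => y.
  by rewrite addr0 /upd {2}/splice /= (negbTE ut); ring.
- move=> Phi Psi cP ihP cQ ihQ g bg.
  apply: cyl_ext (cylD (ihP _ bg) (ihQ _ bg)) => w.
  have [b1 _] := bBrhoM rho_adm bg (cyl_bBrho rho_adm hE (pred1 t) w cP).
  have [b2 _] := bBrhoM rho_adm bg (cyl_bBrho rho_adm hE (pred1 t) w cQ).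
  have := feller_lin fP 1 d0 b1 b2.
  move=> /(congr1 (fun h => h (w s))); rewrite mul1r => <-.
  by congr (P _ _ _); apply/funext => y; rewrite mul1r mulrDr.
- move=> Phi Psi_ cQ ih h g bg; have [_ [M gM]] := bg.
  have cP : cyl F Phi by exact: cyl_lim_seq cQ h.
  apply: cyl_lim => e e0.
  have M0 : 0 <= M by exact: le_trans (gM point).
  have M1 : 0 < M + 1 by lra.
  pose n := Num.truncn ((M + 1) / e).
  have nP : M * n.+1%:R^-1 <= e.
    apply: (@le_trans _ _ ((M + 1) * n.+1%:R^-1)).
      by rewrite ler_wpM2r// lerDl.
    by rewrite ler_pdivrMr// mulrC -ler_pdivrMr// ltW// -truncn_le_nat.
  exists (fun w => P (t%:num - s%:num) (fun y => g y * Psi_ n (upd w t y)) (w s)).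
    exact: ih.
  move=> w.
  have [b1 _] := bBrhoM rho_adm bg (cyl_bBrho rho_adm hE (pred1 t) w cP).
  have [b2 _] := bBrhoM rho_adm bg (cyl_bBrho rho_adm hE (pred1 t) w (cQ n)).
  rewrite [X in `|X|](_ : _ = P (t%:num - s%:num)
    (fun y => -1 * (g y * Psi_ n (upd w t y)) + g y * Phi (upd w t y)) (w s)); last first.
    by rewrite (feller_lin fP)// mulN1r addrC.
  apply: (le_trans _ nP).
  apply: (feller_norm rho_adm hE fP P1 d0); first exact: Brho_lin.
  move=> y; rewrite mulN1r addrC -mulrBr normrM.
  by rewrite ler_pM.
Qed.

Lemma cyl_steps F G s Phi : path leT s F -> cyl G Phi ->
  cyl (s :: F ++ G) (steps s F Phi).
Proof.
elim: F s => [|t F ih] s /=.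
  by move=> _; apply: cyl_sub => u; rewrite inE orbC => ->.
move=> /andP[st tF] cP; apply: cyl_step (ih t tF cP) => //; first exact: mem_head.
by move=> u; rewrite mem_filter !inE => /andP[_ ->]; rewrite orbT.
Qed.

Lemma steps_lin F G s a Phi Psi : path leT s F -> cyl G Phi -> cyl G Psi ->
  steps s F (fun w => a * Phi w + Psi w) =
  (fun w => a * steps s F Phi w + steps s F Psi w).
Proof.
move=> + cP cQ; elim: F s => [//|t F ih] s /= /andP[st tF].
rewrite (ih t tF); apply/funext => w; rewrite /step.
have d0 : 0 <= t%:num - s%:num by rewrite subr_ge0.
have [b1 _] := cyl_bBrho rho_adm hE (pred1 t) w (cyl_steps tF cP).
have [b2 _] := cyl_bBrho rho_adm hE (pred1 t) w (cyl_steps tF cQ).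
exact: (congr1 (fun h => h (w s)) (feller_lin fP a d0 b1 b2)).
Qed.

Lemma steps_ge0 F G s Phi : path leT s F -> cyl G Phi -> (forall w, 0 <= Phi w) ->
  forall w, 0 <= steps s F Phi w.
Proof.
move=> + cP P0; elim: F s => [//|t F ih] s /= /andP[st tF] w.
have [b1 _] := cyl_bBrho rho_adm hE (pred1 t) w (cyl_steps tF cP).
apply: (feller_ge0 fP _ b1) => [|y]; first by rewrite subr_ge0.
exact: ih.
Qed.

Definition indep Phi u := forall w y, Phi (upd w u y) = Phi w.

Lemma updC w s t x y : s != t -> upd (upd w s x) t y = upd (upd w t y) s x.
Proof.
move=> st; apply/funext => u; rewrite /upd /splice /=.
by have [->|] := eqVneq u t; first by rewrite eq_sym (negbTE st).
Qed.

Lemma upd_idem w t x y : upd (upd w t x) t y = upd w t y.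
Proof. by apply/funext => u; rewrite /upd /splice /=; case: eqP. Qed.

Lemma cyl_indep G Phi u : cyl G Phi -> u \notin G -> indep Phi u.
Proof.
move=> cP uG w y; apply: cyl_eq cP _ => t tG.
by rewrite /upd /splice /=; case: eqP => // tu; rewrite -tu tG in uG.
Qed.

Lemma steps_indep s F Phi u : indep Phi u -> u != s -> indep (steps s F Phi) u.
Proof.
move=> iP; elim: F s => [//|t F ih] s us w y /=; rewrite /step.
have -> : upd w u y s = w s by rewrite /upd /splice /= eq_sym (negbTE us).
congr (P _ _ _); apply/funext => x.
have [->|ut] := eqVneq u t; first by rewrite upd_idem.
by rewrite updC// ih.
Qed.

(** Consistency at a time [u] that [Phi] does not see: before a later time it is the semigroup law
    for [(t - u) + (u - s)], at the end of the list it is preservation of constants. *)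
Lemma steps_insert s u F G Phi : path leT s (u :: F) -> u \notin F ->
  cyl G Phi -> u \notin G -> steps s (u :: F) Phi = steps s F Phi.
Proof.
move=> + + cP uG; have iP := cyl_indep cP uG.
case: F => [|t F] /=.
  rewrite andbT => su _; apply/funext => w; rewrite /step.
  rewrite (_ : (fun y => _) = (fun=> Phi w)).
    by rewrite (feller_cst rho_adm hE)// subr_ge0.
  by apply/funext => y; rewrite iP.
move=> /and3P[su ut tF]; rewrite inE negb_or => /andP[ut' uF].
apply/funext => w; rewrite /step.
have [b1 _] := cyl_bBrho rho_adm hE (pred1 t) w (cyl_steps tF cP).
rewrite (_ : t%:num - s%:num = (t%:num - u%:num) + (u%:num - s%:num)); last by ring.
rewrite (@fellerD _ _ _ _ fP (u%:num - s%:num) (t%:num - u%:num)) ?subr_ge0//.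
congr (P _ _ _); apply/funext => y.
have -> : upd w u y u = y by rewrite /upd /splice /= eqxx.
congr (P _ _ _); apply/funext => x.
by rewrite updC// (steps_indep F iP).
Qed.

Lemma steps_subseq s F F' G Phi : path leT s F' -> uniq F' -> subseq F F' ->
  cyl G Phi -> {subset G <= F} -> steps s F' Phi = steps s F Phi.
Proof.
move=> + + + cP GF.
(* This consequence of [GF] survives the induction, whereas the inclusion of [G] in [F] is lost when
   [F] drops its head. *)
have : forall u, u \in F' -> u \notin F -> u \notin G.
  by move=> u _; apply: contra; exact: GF.
elim: F' s F {GF} => [|u F' ih] s F; first by case: F.
move=> FG sF' uF'; case: F FG => [|v F] FG.
  move=> _; rewrite (@steps_insert _ _ _ G)//; last 2 first.
  - by case/andP: uF'.
  - by apply: FG => //; exact: mem_head.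
  apply: ih => //.
  - by move=> t tF; apply: FG; rewrite inE tF orbT.
  - by case: (F') sF' => //= t F2 /and3P[su ut ->]; rewrite (leT_trans su ut).
  - by case/andP: uF'.
  - exact: sub0seq.
rewrite [subseq _ _]/=; case: eqP FG => [->|/eqP vu] FG sub.
  rewrite /=; congr step; apply: ih => //.
  - move=> t tF' tF; apply: FG; first by rewrite inE tF' orbT.
    rewrite inE negb_or tF andbT; apply: contraTN tF' => /eqP ->.
    by case/andP: uF'.
  - by case/andP: sF'.
  - by case/andP: uF'.
have uvF : u \notin v :: F.
  by apply/negP => /(mem_subseq sub); apply/negP; case/andP: uF'.
rewrite (@steps_insert _ _ _ G)//; last 2 first.
- by case/andP: uF'.
- by apply: FG => //; exact: mem_head.
apply: ih => //.
- by move=> t tF; apply: FG; rewrite inE tF orbT.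
- by case: (F') sF' => //= t F2 /and3P[su ut ->]; rewrite (leT_trans su ut).
- by case/andP: uF'.
Qed.

Lemma steps_cat s F F' Phi :
  steps s (F ++ F') Phi = steps s F (steps (last s F) F' Phi).
Proof. by elim: F s => //= t F ih s; rewrite ih. Qed.

(** Once [F] contains the times of [Phi], the iterated function depends on [w 0%:nng] alone, so
    evaluation at a constant path loses nothing. *)
Definition fdd F Phi : R := \int[nu]_x (steps 0%:nng F Phi (fun=> x)).

Definition tsort F := sort leT (undup F).

Lemma tsort_path F : path leT 0%:nng (tsort F).
Proof.
have := sort_sorted leT_total (undup F); rewrite -/(tsort F).
by case: tsort => //= t G ->; rewrite leT0.
Qed.

Lemma mem_tsort F : tsort F =i F.
Proof. by move=> t; rewrite mem_sort mem_undup. Qed.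

Lemma tsort_uniq F : uniq (tsort F).
Proof. by rewrite sort_uniq undup_uniq. Qed.

(* The choice of the supporting times is immaterial by [LcylE]. *)
Definition Lcyl Phi : R := fdd (tsort (xget [::] [set G | cyl G Phi])) Phi.

Lemma tsort_subseq F F' : uniq F -> path leT 0%:nng F -> {subset F <= F'} ->
  subseq F (tsort F').
Proof.
move=> uF sF FF'; rewrite (_ : F = [seq t <- tsort F' | t \in F]).
  exact: filter_subseq.
apply: (sorted_eq leT_trans leT_anti).
- exact: path_sorted sF.
- apply: sorted_filter; first exact: leT_trans.
  exact: path_sorted (tsort_path F').
- apply: uniq_perm => //; first by rewrite filter_uniq// tsort_uniq.
  move=> t; rewrite mem_filter mem_tsort; apply/idP/andP => [tF|[]//].
  by split => //; exact: FF'.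
Qed.

Lemma fdd_sub F F' G Phi : uniq F -> path leT 0%:nng F -> {subset F <= F'} ->
  cyl G Phi -> {subset G <= F} -> fdd (tsort F') Phi = fdd F Phi.
Proof.
move=> uF sF FF' cP GF; rewrite /fdd; apply: eq_Rintegral => x _.
by rewrite (steps_subseq (tsort_path F') (tsort_uniq F') _ cP GF)// tsort_subseq.
Qed.

(** The chosen list and [F] are both compared with the sorted union of the two, obtained from each
    by inserting times that [Phi] does not see. *)
Lemma LcylE F G Phi : uniq F -> path leT 0%:nng F -> cyl G Phi ->
  {subset G <= F} -> Lcyl Phi = fdd F Phi.
Proof.
move=> uF sF cP GF; rewrite /Lcyl; set H := xget _ _.
have cH : cyl H Phi by rewrite /H; case: xgetP => // /(_ G).
rewrite -(@fdd_sub F (F ++ H) G)//; last by move=> t; rewrite mem_cat => ->.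
rewrite -(@fdd_sub (tsort H) (F ++ H) H)//.
- exact: tsort_uniq.
- exact: tsort_path.
- by move=> t; rewrite mem_tsort mem_cat orbC => ->.
- by move=> t; rewrite mem_tsort.
Qed.

Lemma steps_bBrho F G Phi : path leT 0%:nng F -> cyl G Phi ->
  bBrho rho (fun x => steps 0%:nng F Phi (fun=> x)).
Proof.
move=> sF cP.
exact: (cyl_bBrho rho_adm hE xpredT (fun=> point) (cyl_steps sF cP)).
Qed.

Lemma bBrho_integrable (f : E -> R) : bBrho rho f ->
  nu.-integrable setT (EFin \o (f : Borel E -> R)).
Proof.
move=> [bf [M fM]].
exact: (bounded_integrable nu (Brho_measurable rho_adm bf) fM).
Qed.

Lemma Lcyl_lin G a Phi Psi : cyl G Phi -> cyl G Psi ->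
  Lcyl (fun w => a * Phi w + Psi w) = a * Lcyl Phi + Lcyl Psi.
Proof.
move=> cP cQ.
have G' : {subset G <= tsort G} by move=> t; rewrite mem_tsort.
have cPQ := cylD (cylZ a cP) cQ.
rewrite !(LcylE (tsort_uniq G) (tsort_path G) _ G')// /fdd.
rewrite (steps_lin a (tsort_path G) cP cQ).
have b1 := steps_bBrho (tsort_path G) cP; have b2 := steps_bBrho (tsort_path G) cQ.
rewrite -RintegralZl//; last exact: bBrho_integrable.
rewrite -RintegralD//; last exact: bBrho_integrable.
exact/bBrho_integrable/bBrhoZ.
Qed.

Lemma Lcyl_ge0 G Phi : cyl G Phi -> (forall w, 0 <= Phi w) -> 0 <= Lcyl Phi.
Proof.
move=> cP P0.
have G' : {subset G <= tsort G} by move=> t; rewrite mem_tsort.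
rewrite !(LcylE (tsort_uniq G) (tsort_path G) cP G')// /fdd.
by apply: Rintegral_ge0 => x _; exact: steps_ge0 (tsort_path G) cP P0 _.
Qed.

Lemma Lcyl0 f : bBrho rho f ->
  Lcyl (fun w => f (w 0%:nng)) = \int[nu]_x f x.
Proof.
move=> bf.
have c1 : cyl [:: 0%:nng] (fun w => f (w 0%:nng)).
  apply: cyl_ext (cyl_coord (mem_head _ _) bf (cyl_cst _ _ 1)) => w.
  by rewrite mulr1.
rewrite (@LcylE [:: 0%:nng] _ _ _ _ c1)//= ?leT0// /fdd /=.
apply: eq_Rintegral => x _; rewrite /step subrr.
have bu : (fun y => f (upd (fun=> x) 0%:nng y 0%:nng)) = f.
  by apply/funext => y; rewrite /upd /splice /= eqxx.
by rewrite bu (feller0 fP)//; case: bf.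
Qed.

(** Let [F0] be the times of [Phi] other than [s]. Along [F0], [s], [t] the innermost [P] acts on
    [f] alone, because [Phi] does not see [t]. The case [s = t] is separate since the times in the
    list must be distinct. *)
Lemma Lcyl_markov G s t f Phi : cyl G Phi -> (forall u, u \in G -> leT u s) ->
  leT s t -> bBrho rho f ->
  Lcyl (fun w => f (w t) * Phi w) =
  Lcyl (fun w => P (t%:num - s%:num) f (w s) * Phi w).
Proof.
move=> cP Gs st bf; have [->|st'] := eqVneq s t.
  by rewrite subrr (feller0 fP)//; case: bf.
have d0 : 0 <= t%:num - s%:num by rewrite subr_ge0.
pose F0 := tsort [seq u <- G | u != s].
have F0s u : u \in F0 -> leT u s.
  by rewrite mem_tsort mem_filter => /andP[_]; exact: Gs.
have ltst : s%:num < t%:num.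
  rewrite lt_neqAle (st : s%:num <= t%:num) andbT.
  by apply: contra st' => /eqP/val_inj ->.
have ts : ~~ leT t s by rewrite /leT -ltNge.
have tF0 : t \notin F0 by apply: contra ts; exact: F0s.
have sF0 : s \notin F0 by rewrite mem_tsort mem_filter eqxx.
have tG : t \notin G by apply: contra ts; exact: Gs.
have GF : {subset G <= F0 ++ [:: s]}.
  move=> u uG; rewrite mem_cat mem_tsort mem_filter uG andbT inE.
  by rewrite orbC orbN.
have lF0 : leT (last 0%:nng F0) s.
  have : forall F x0, (forall u, u \in F -> leT u s) -> leT x0 s -> leT (last x0 F) s.
    elim=> //= v F ih x0 Fs _; apply: ih => [u uF|]; apply: Fs.
      by rewrite inE uF orbT.
    exact: mem_head.
  by apply => //; exact: leT0.
have cPt := cyl_sub (fun u uG => mem_behead (s := t :: G) uG) cP.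
have c1 := cyl_coord (mem_head t G) bf cPt.
have cPs := cyl_sub (fun u uG => mem_behead (s := s :: G) uG) cP.
have c2 := cyl_coord (mem_head s G) (feller_bBrho rho_adm hE fP P1 d0 bf) cPs.
rewrite (@LcylE (F0 ++ [:: s; t]) _ _ _ _ c1); last 3 first.
- by rewrite cat_uniq tsort_uniq /= !inE (negbTE sF0) (negbTE tF0) /= st'.
- by rewrite cat_path tsort_path /= lF0 st.
- move=> u; rewrite inE => /orP[/eqP->|/GF]; rewrite !mem_cat !inE ?eqxx ?orbT//.
  by move=> /orP[->//|->]; rewrite orbT.
rewrite (@LcylE (F0 ++ [:: s]) _ _ _ _ c2); last 3 first.
- by rewrite cat_uniq tsort_uniq /= (negbTE sF0).
- by rewrite cat_path tsort_path /= lF0.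
- by move=> u; rewrite inE => /orP[/eqP->|/GF//]; rewrite mem_cat inE eqxx orbT.
rewrite /fdd !steps_cat /=; apply: eq_Rintegral => x _.
congr (steps _ _ (step _ _ _) _); apply/funext => w; rewrite /step.
have [[bf' _] [b0 _]] := (bf, bBrho_cst rho_adm hE 0).
have := feller_lin fP (Phi w) d0 bf' b0.
rewrite (feller_cst rho_adm hE fP P1 _ d0) => /(congr1 (fun h => h (w s))).
rewrite addr0 mulrC => <-; congr (P _ _ _); apply/funext => y.
rewrite addr0 (cyl_indep cP tG) mulrC.
by rewrite /upd /splice /= eqxx.
Qed.

End finite_dimensional.

(** * Tightness and countable subadditivity *)

Section geometric.
Context {R : realType}.

(** Through an injective enumeration of countably many times this becomes a total error budget,
    whatever finite set of times occurs. *)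
Lemma sum_half_uniq (s : seq nat) : uniq s ->
  \sum_(i <- s) (2^-1 : R) ^+ i.+1 <= 1.
Proof.
move=> us; pose N := (\max_(i <- s) i).+1.
have sN i : i \in s -> (i < N)%N.
  by move=> si; rewrite ltnS; exact: (@leq_bigmax_seq _ s xpredT id i si).
have geo n : \sum_(i < n) (2^-1 : R) ^+ i.+1 = 1 - 2^-1 ^+ n.
  elim: n => [|n ih]; first by rewrite big_ord0 expr0 subrr.
  by rewrite big_ord_recr/= ih exprS; field.
have ps : perm_eq s [seq i <- iota 0 N | i \in s].
  apply: uniq_perm => //; first by rewrite filter_uniq// iota_uniq.
  move=> i; rewrite mem_filter mem_iota /= add0n; apply/idP/andP => [si|[]//].
  by split => //; exact: sN.
rewrite (perm_big _ ps) big_filter /= big_mkcond /=.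
apply: (@le_trans _ _ (\sum_(i <- iota 0 N) (2^-1 : R) ^+ i.+1)).
  by apply: ler_sum => i _; case: ifP => // _; rewrite exprn_ge0.
rewrite -[iota 0 N]/(index_iota 0 N) big_mkord geo gerBl exprn_ge0//.
Qed.

End geometric.

(** * Cylinder functions with times in an arbitrary set *)

Section cylinder_class.
Context {R : realType} {E : ptopologicalType} {T : eqType} (rho : E -> R).
Hypothesis rho_adm : admissible_weight rho.
Hypothesis hE : hausdorff_space E.
Local Notation X := (T -> E).
Implicit Types (S : set T) (Phi Psi : X -> R).

(** Hiding the list [F] leaves a possibly infinite [S]: the countable set of times of an open set,
    or the whole past of a time. *)
Definition Cyl S Phi := exists2 F : seq T, (forall t, t \in F -> S t) & cyl rho F Phi.

Lemma Cyl_common S Phi Psi : Cyl S Phi -> Cyl S Psi ->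
  exists F : seq T, [/\ forall t, t \in F -> S t, cyl rho F Phi & cyl rho F Psi].
Proof.
move=> [F FS cP] [G GS cQ]; exists (F ++ G); split.
- by move=> t; rewrite mem_cat => /orP[/FS|/GS].
- by apply: cyl_sub cP => t; rewrite mem_cat => ->.
- by apply: cyl_sub cQ => t; rewrite mem_cat orbC => ->.
Qed.

Lemma Cyl_sub S S' Phi : S `<=` S' -> Cyl S Phi -> Cyl S' Phi.
Proof. by move=> SS' [F FS cP]; exists F => // t /FS/SS'. Qed.

Lemma Cyl_ext S Phi Psi : Phi =1 Psi -> Cyl S Phi -> Cyl S Psi.
Proof. by move=> /funext ->. Qed.

Lemma Cyl_cst S a : Cyl S (fun=> a).
Proof. by exists [::] => //; exact: cyl_cst. Qed.

Lemma Cyl_coord S t f : S t -> bBrho rho f -> Cyl S (fun w => f (w t)).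
Proof.
move=> St bf; exists [:: t]; first by move=> u; rewrite inE => /eqP->.
apply: cyl_ext (cyl_coord (mem_head _ _) bf (cyl_cst _ _ 1)) => w.
by rewrite mulr1.
Qed.

Lemma CylD S Phi Psi : Cyl S Phi -> Cyl S Psi -> Cyl S (fun w => Phi w + Psi w).
Proof.
by move=> cP cQ; have [F [FS ? ?]] := Cyl_common cP cQ; exists F => //; exact: cylD.
Qed.

Lemma CylZ S a Phi : Cyl S Phi -> Cyl S (fun w => a * Phi w).
Proof. by move=> [F FS cP]; exists F => //; exact: cylZ. Qed.

Lemma CylB S Phi Psi : Cyl S Phi -> Cyl S Psi -> Cyl S (fun w => Phi w - Psi w).
Proof.
by move=> cP cQ; have [F [FS ? ?]] := Cyl_common cP cQ; exists F => //; exact: cylB.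
Qed.

Lemma CylM S Phi Psi : Cyl S Phi -> Cyl S Psi -> Cyl S (fun w => Phi w * Psi w).
Proof.
by move=> cP cQ; have [F [FS ? ?]] := Cyl_common cP cQ; exists F => //; exact: cylM.
Qed.

Lemma Cyl_max S Phi Psi : Cyl S Phi -> Cyl S Psi ->
  Cyl S (fun w => Num.max (Phi w) (Psi w)).
Proof.
by move=> cP cQ; have [F [FS ? ?]] := Cyl_common cP cQ; exists F => //; exact: cyl_max.
Qed.

Lemma Cyl_min S Phi Psi : Cyl S Phi -> Cyl S Psi ->
  Cyl S (fun w => Num.min (Phi w) (Psi w)).
Proof.
by move=> cP cQ; have [F [FS ? ?]] := Cyl_common cP cQ; exists F => //; exact: cyl_min.
Qed.

Lemma Cyl_sum S (Phi_ : nat -> X -> R) n : (forall k, Cyl S (Phi_ k)) ->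
  Cyl S (fun w => \sum_(k < n) Phi_ k w).
Proof.
move=> h; elim: n => [|n ih].
  by apply: Cyl_ext (Cyl_cst S 0) => w; rewrite big_ord0.
by apply: Cyl_ext (CylD ih (h n)) => w; rewrite big_ord_recr.
Qed.

(** Coordinatewise from [bBrho_continuous_sublevel]: a cylinder function is continuous along a
    product of sublevel sets, the form in which compactness of that product is used. *)
Lemma Cyl_continuous_sublevel S Phi (r : T -> R)
    (w : prod_topology (fun _ : T => E)) (e : R) : Cyl S Phi ->
  (forall t, rho (w t) <= r t) -> 0 < e ->
  \forall w' \near w,
    (forall t, rho (w' t) <= r t) -> `|Phi w' - Phi w| < e.
Proof.
move=> [F _ cP] wr; elim: cP e => {Phi}.
- by move=> a e e0; apply: (@nearW _ (nbhs w)) => w' _; rewrite subrr normr0.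
- move=> t f Phi tF bf cP ih e e0; have [_ [M fM]] := bf.
  have M0 : 0 <= M by exact: le_trans (fM point).
  have [N PN] := cyl_bounded cP.
  have N0 : 0 <= N by exact: le_trans (PN (fun=> point)).
  have eN : 0 < e / 2 / (N + 1) by rewrite !divr_gt0//; lra.
  have eM : 0 < e / 2 / (M + 1) by rewrite !divr_gt0//; lra.
  have := bBrho_continuous_sublevel rho_adm bf (wr t) eN.
  move=> /(@proj_continuous T (fun=> E) t w).
  apply: filterS2 (ih _ eM) => w' h1 h2 w'r.
  move: (h1 w'r) (h2 (w'r t)); rewrite /proj => {}h1 {}h2.
  have -> : f (w' t) * Phi w' - f (w t) * Phi w =
    (f (w' t) - f (w t)) * Phi w' + f (w t) * (Phi w' - Phi w) by ring.
  rewrite (le_lt_trans (ler_normD _ _))// !normrM.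
  have k1 : `|f (w' t) - f (w t)| * `|Phi w'| <= e / 2 / (N + 1) * N.
    by rewrite ler_pM// ltW.
  have k2 : `|f (w t)| * `|Phi w' - Phi w| <= M * (e / 2 / (M + 1)).
    by rewrite ler_pM// ltW.
  have k3 : e / 2 / (N + 1) * N < e / 2.
    by rewrite mulrAC ltr_pdivrMr ?ltr_pM2l ?divr_gt0//; lra.
  have k4 : M * (e / 2 / (M + 1)) < e / 2.
    by rewrite mulrC mulrAC ltr_pdivrMr ?ltr_pM2l ?divr_gt0//; lra.
  lra.
- move=> Phi Psi _ ih1 _ ih2 e e0.
  have e2 : 0 < e / 2 by rewrite divr_gt0.
  apply: filterS2 (ih1 _ e2) (ih2 _ e2) => w' h1 h2 w'r.
  have -> : Phi w' + Psi w' - (Phi w + Psi w) =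
    (Phi w' - Phi w) + (Psi w' - Psi w) by ring.
  rewrite (le_lt_trans (ler_normD _ _))//.
  by have := h1 w'r; have := h2 w'r; lra.
- move=> Phi Psi_ _ ih h e e0.
  have e3 : 0 < e / 3 by rewrite divr_gt0.
  pose n := Num.truncn (e / 3)^-1.
  have nP : n.+1%:R^-1 <= e / 3.
    rewrite -[leRHS]invrK lef_pV2 ?posrE ?invr_gt0// ltW//.
    by rewrite -truncn_le_nat.
  apply: filterS (ih n _ e3) => w' h1 w'r.
  have h2 := le_trans (h n w) nP; have h3 := le_trans (h n w') nP.
  have -> : Phi w' - Phi w =
    (Phi w' - Psi_ n w') - (Phi w - Psi_ n w) + (Psi_ n w' - Psi_ n w) by ring.
  rewrite (le_lt_trans (ler_normD _ _))//.
  have := ler_normB (Phi w' - Psi_ n w') (Phi w - Psi_ n w).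
  by have := h1 w'r; lra.
Qed.

End cylinder_class.

(** * Bounds for the functional [L] and subadditivity on open sets *)

Section outer.
Context {R : realType} {E : ptopologicalType} (rho : E -> R).
Hypothesis rho_adm : admissible_weight rho.
Hypothesis hE : hausdorff_space E.
Variable P : R -> (E -> R) -> (E -> R).
Hypothesis fP : generalized_Feller rho P.
Hypothesis P1 : forall t : R, 0 <= t -> P t (fun _ => 1) = (fun _ => 1).
Variable nu : probability (Borel E) R.
Hypothesis nu_rho : (\int[nu]_x (rho x)%:E < +oo)%E.

Local Notation T := {nonneg R}.
Local Notation X := (T -> E).
Local Notation Cyl := (Cyl (T := T) rho).
Local Notation L := (Lcyl rho P nu).
Implicit Types (S : set T) (Phi Psi : X -> R) (w z : X) (s t u : T) (U V : set X).

Lemma L_lin S a Phi Psi : Cyl S Phi -> Cyl S Psi ->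
  L (fun w => a * Phi w + Psi w) = a * L Phi + L Psi.
Proof.
move=> cP cQ; have [F [_ cP' cQ']] := Cyl_common cP cQ.
exact: Lcyl_lin cP' cQ'.
Qed.

Lemma L_ge0 S Phi : Cyl S Phi -> (forall w, 0 <= Phi w) -> 0 <= L Phi.
Proof. by move=> [F _ cP]; exact: Lcyl_ge0 cP. Qed.

Lemma L_cst a : L (fun=> a) = a.
Proof.
rewrite (Lcyl0 rho_adm hE fP P1 nu (bBrho_cst rho_adm hE a)).
have nuT : nu setT = 1%E by exact: probability_setT.
transitivity (a * fine (nu setT)); first exact: Rintegral_cst.
by rewrite nuT mulr1.
Qed.

Lemma LD S Phi Psi : Cyl S Phi -> Cyl S Psi ->
  L (fun w => Phi w + Psi w) = L Phi + L Psi.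
Proof.
move=> cP cQ; rewrite -[L Phi]mul1r -(L_lin 1 cP cQ).
by congr L; apply/funext => w; rewrite mul1r.
Qed.

Lemma LZ S a Phi : Cyl S Phi -> L (fun w => a * Phi w) = a * L Phi.
Proof.
move=> cP; have := L_lin a cP (Cyl_cst rho S 0); rewrite L_cst addr0 => <-.
by congr L; apply/funext => w; rewrite addr0.
Qed.

Lemma LB S Phi Psi : Cyl S Phi -> Cyl S Psi ->
  L (fun w => Phi w - Psi w) = L Phi - L Psi.
Proof.
move=> cP cQ; rewrite addrC -[- L Psi]mulN1r -(L_lin _ cQ cP).
by congr L; apply/funext => w; rewrite mulN1r addrC.
Qed.

Lemma L_le S Phi Psi : Cyl S Phi -> Cyl S Psi -> (forall w, Phi w <= Psi w) ->
  L Phi <= L Psi.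
Proof.
move=> cP cQ PQ; rewrite -subr_ge0 -(LB cQ cP).
by apply: (L_ge0 (CylB cQ cP)) => w; rewrite subr_ge0.
Qed.

Lemma L_sum S (Phi_ : nat -> X -> R) n : (forall k, Cyl S (Phi_ k)) ->
  L (fun w => \sum_(k < n) Phi_ k w) = \sum_(k < n) L (Phi_ k).
Proof.
move=> h; elim: n => [|n ih].
  rewrite big_ord0 -[RHS]L_cst.
  by congr L; apply/funext => w; rewrite big_ord0.
rewrite big_ord_recr /= -ih -(LD (Cyl_sum n h) (h n)).
by congr L; apply/funext => w; rewrite big_ord_recr.
Qed.

Lemma L_coord t f : bBrho rho f ->
  L (fun w => f (w t)) = \int[nu]_x P t%:num f x.
Proof.
move=> bf.
have h0 : forall u : T, u \in [::] -> leT u 0%:nng by [].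
have := Lcyl_markov rho_adm hE fP P1 nu (cyl_cst rho [::] 1) h0 (leT0 t) bf.
rewrite subr0 => LM.
rewrite -(Lcyl0 rho_adm hE fP P1); last exact: feller_bBrho.
transitivity (L (fun w => f (w t) * 1)).
  by congr L; apply/funext => w; rewrite mulr1.
by rewrite LM; congr L; apply/funext => w; rewrite mulr1.
Qed.

(** The finite [rho]-moment of [nu] enters here: [K] is this moment times the weighted bound of
    [P t]. For a function with values in [[0, 1]] that vanishes where [rho <= r], it gives the
    Chebyshev bound [K / r]. *)
Lemma L_coord_rho t : exists2 K : R, 0 <= K & forall f (M : R), bBrho rho f ->
  (forall x, `|f x| <= M * rho x) -> `|L (fun w => f (w t))| <= K * M.
Proof.
have t0 : 0 <= t%:num by [].
have [C C0 hC] := feller_rho rho_adm fP t0.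
have rint : nu.-integrable setT (EFin \o (rho : Borel E -> R)).
  apply/integrableP; split.
    by apply/measurable_EFinP; exact: (rho_measurable rho_adm hE).
  apply: le_lt_trans nu_rho; rewrite le_eqVlt; apply/orP; left; apply/eqP.
  by apply: eq_integral => x _ /=; rewrite gtr0_norm//; case: rho_adm.
exists (C * \int[nu]_x rho x).
  rewrite mulr_ge0// Rintegral_ge0// => x _.
  by rewrite ltW//; case: rho_adm.
move=> f M bf fM; rewrite L_coord//.
have bPf := feller_bBrho rho_adm hE fP P1 t0 bf.
have iPf := bBrho_integrable rho_adm nu bPf.
rewrite (le_trans (le_normr_Rintegral _ _))//.
have -> : C * (\int[nu]_x rho x) * M = \int[nu]_x (C * M * rho x).
  by rewrite RintegralZl//; ring.
apply: le_Rintegral => //.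
- exact: integrable_norm.
- by have := integrableZl measurableT (C * M) rint; apply: eq_integrable.
- by move=> x _; apply: hC => //; case: bf.
Qed.

(* The times of [F'] are removed one by one: [h y], the supremum of [Theta] over
   the paths equal to [y] at time [t] and lying in the sublevel sets at the other
   times, is in [B^rho] by [cyl_sup], is dominated by [rho / r t], and
   [max (Theta - h (w t)) 0] vanishes without any condition at time [t]. *)
Lemma L_tight (K r : T -> R) (F' : seq T) Theta :
  (forall t, 0 <= K t) ->
  (forall t f (M : R), bBrho rho f -> (forall x, `|f x| <= M * rho x) ->
    `|L (fun w => f (w t))| <= K t * M) ->
  (forall t, rho point <= r t) ->
  Cyl setT Theta -> (forall w, 0 <= Theta w <= 1) ->
  (forall w, (forall t, t \in F' -> rho (w t) <= r t) -> Theta w = 0) ->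
  L Theta <= \sum_(t <- F') K t / r t.
Proof.
move=> K0 LK rpt; have rho0 x : 0 < rho x by case: rho_adm.
have r0 t : 0 < r t by exact: lt_le_trans (rpt t).
elim: F' Theta => [|t F' ih] Theta cT T01 Tvan.
  rewrite big_nil (_ : Theta = (fun=> 0)) ?L_cst//.
  by apply/funext => w; exact: Tvan.
pose Z : set X := [set z | forall u, u \in F' -> rho (z u) <= r u].
pose H w := sup [set Theta (splice (pred1 t) w z) | z in Z].
(* The assumption [rho point <= r t] makes [Z] nonempty, so that the suprema in [H] are genuine. *)
have Zpt : Z (fun=> point) by move=> u _.
have Sub w : has_ubound [set Theta (splice (pred1 t) w z) | z in Z].
  by exists 1 => _ [z _ <-]; case/andP: (T01 (splice (pred1 t) w z)).
have [F _ cF] := cT.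
have cH : cyl rho [seq u <- F | pred1 t u] H.
  by apply: cyl_sup cF _ => //; exists (fun=> point).
pose h y := H (fun=> y).
have bh : bBrho rho h by exact: (cyl_bBrho rho_adm hE xpredT (fun=> point) cH).
have Hh w : H w = h (w t).
  rewrite /h /H; congr sup; apply: eq_imagel => z _; congr Theta.
  by apply/funext => u; rewrite /splice /=; case: eqP => [->|].
have h0 y : 0 <= h y.
  apply: le_trans (ub_le_sup (Sub _) (imageP _ Zpt)).
  by case/andP: (T01 (splice (pred1 t) (fun=> y) (fun=> point))).
have h1 y : h y <= 1.
  apply: ge_sup; first by exists (Theta (splice (pred1 t) (fun=> y) (fun=> point))), (fun=> point).
  by move=> _ [z _ <-]; case/andP: (T01 (splice (pred1 t) (fun=> y) z)).
have hv y : rho y <= r t -> h y = 0.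
  move=> yr; apply/le_anti; rewrite h0 andbT; apply: ge_sup.
    by exists (Theta (splice (pred1 t) (fun=> y) (fun=> point))), (fun=> point).
  move=> _ [z Zz <-]; rewrite Tvan// => u; rewrite inE /splice /=.
  by case: eqP => [->//|_ /= /Zz].
have Lh : L (fun w => h (w t)) <= K t / r t.
  apply: le_trans (ler_norm _) _; apply: LK => // y.
  rewrite ger0_norm//; have [/hv->|yr] := leP (rho y) (r t).
    by rewrite mulr_ge0 ?invr_ge0// ltW.
  by rewrite (le_trans (h1 y))// mulrC ler_pdivlMr// mul1r ltW.
have ch : Cyl setT (fun w => h (w t)) by exact: Cyl_coord.
pose Th w := Num.max (Theta w - h (w t)) 0.
have cTh : Cyl setT Th by apply: Cyl_max (CylB cT ch) (Cyl_cst _ _ 0).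
have := ih Th cTh _ _; rewrite big_cons => ihT.
apply: (@le_trans _ _ (L (fun w => h (w t) + Th w))).
  apply: (L_le cT (CylD ch cTh)) => w.
  by rewrite -lerBlDl /Th le_max lexx.
rewrite (LD ch cTh) lerD// ihT// => w.
  rewrite /Th le_max lexx orbT /= ge_max ler01 andbT.
  by have := T01 w; have := h0 (w t); lra.
move=> Zw; rewrite /Th; apply/max_idPr; rewrite subr_le0 -Hh.
apply: ub_le_sup => //; exists w => //; congr Theta.
by apply/funext => u; rewrite /splice; case: ifP.
Qed.

Definition below U Phi :=
  [/\ Cyl setT Phi, forall w, 0 <= Phi w <= 1 & forall w, 0 < Phi w -> U w].

(** Each point of [U] has its own [Phi], so uncountable unions are allowed as long as all times lie
    in [S]. Preimages of open subsets of [E] at a single time are of this kind. *)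
Definition cyl_open S U := forall w, U w ->
  exists Phi, [/\ Cyl S Phi, forall w, 0 <= Phi w <= 1,
                  forall w, 0 < Phi w -> U w & 0 < Phi w].

Definition cyl_copen U := exists2 S : set T, countable S & cyl_open S U.

(** On the compact product [KK], [Phi] is at most [d] plus a finite sum of functions below the
    [U_ n]; the excess vanishes on [KK], and [L_tight] bounds its cost by a second [d]. *)
Lemma below_bigcup (U_ : nat -> set X) Phi (e : R) :
  (forall n, cyl_copen (U_ n)) -> below (\bigcup_n U_ n) Phi -> 0 < e ->
  exists (N : nat) (V : nat -> X -> R), (forall n, below (U_ n) (V n)) /\
    L Phi <= \sum_(n < N) L (V n) + e.
Proof.
move=> oU [cP P01 PU] e0.
have /choice[S_ SP] : forall n, exists S : set T, countable S /\ cyl_open S (U_ n).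
  by move=> n; have [S ? ?] := oU n; exists S.
have [F _ cF] := cP.
(* Index 0 holds the times of [Phi], index [n.+1] those of [U_ n]. *)
pose S0 := \bigcup_n (if n is n'.+1 then S_ n' else [set` F]).
have cS0 : countable S0.
  apply: bigcup_countable => // -[|n] _; last by case: (SP n).
  exact/finite_set_countable/finite_seq.
have /countable_injP [idx idxP] := cS0.
have /choice[K KP] : forall t, exists K : R, 0 <= K /\ forall f (M : R), bBrho rho f ->
    (forall x, `|f x| <= M * rho x) -> `|L (fun w => f (w t))| <= K * M.
  by move=> t; have [K ? ?] := L_coord_rho t; exists K.
pose d := e / 2; have d0 : 0 < d by rewrite divr_gt0.
(* Chosen so that [K t / r t] is at most a summable share of [d]; adding [rho point] keeps [r t]
   positive and the constant path at [point] inside [KK]. *)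
pose r t := rho point + K t / (d * 2^-1 ^+ (idx t).+1).
have w0 t : 0 < d * 2^-1 ^+ (idx t).+1 by rewrite mulr_gt0// exprn_gt0.
have rpt t : rho point <= r t.
  by rewrite /r lerDl; apply: divr_ge0; [case: (KP t)|exact: ltW].
have rho0 x : 0 < rho x by case: rho_adm.
have r0 t : 0 < r t by exact: lt_le_trans (rpt t).
have Kr t : K t / r t <= d * 2^-1 ^+ (idx t).+1.
  rewrite ler_pdivrMr// mulrC -ler_pdivrMr// /r.
  by rewrite lerDr ltW.
pose KK : set (prod_topology (fun _ : T => E)) :=
  [set w | forall t, rho (w t) <= r t].
have cKK : compact KK.
  apply: (@tychonoff T (fun=> E) (fun t => [set x | rho x <= r t])) => t.
  by case: rho_adm => _; apply; exact: ltW.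
pose good (NV : nat * (nat -> X -> R)) := forall n, Cyl S0 (NV.2 n) /\ below (U_ n) (NV.2 n).
pose A (NV : nat * (nat -> X -> R)) : set (prod_topology (fun _ : T => E)) :=
  [set w | Phi w <= d + \sum_(n < NV.1) NV.2 n w].
have S0cst a : Cyl S0 (fun=> a) by exact: Cyl_cst.
have good0 : good (0%N, fun _ _ => 0).
  move=> n /=; split => //; split => //; first exact: Cyl_cst.
    by move=> w; rewrite lexx ler01.
  by move=> w; rewrite ltxx.
(* Termwise maxima make the family of finite sums directed; locally, either [Phi < d], or the point
   lies in some [U_ n] and one function suffices. *)
have [|||[N V] /= gV KV] := @compact_directed_cover _ _ KK good A cKK.
- by exists (0%N, fun _ _ => 0).
- move=> [N V] [N' V'] gV gV'.
  pose W n w := Num.max (V n w) (V' n w).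
  have W0 n w : 0 <= W n w.
    by rewrite le_max; have [_ [_ /(_ w)/andP[-> _] _]] := gV n.
  have mono (M M' : nat) (f : nat -> R) : (M <= M')%N -> (forall n, 0 <= f n) ->
      \sum_(n < M) f n <= \sum_(n < M') f n.
    move=> MM' f0; rewrite -!(big_mkord xpredT f) /=.
    by rewrite [leRHS](big_cat_nat _ MM')//= lerDl sumr_ge0.
  exists (maxn N N', W).
    move=> n /=; have [c1 [c1' h1 u1]] := gV n; have [c2 [c2' h2 u2]] := gV' n.
    split; first exact: Cyl_max.
    split; first exact: Cyl_max.
      by move=> w; rewrite W0 /W ge_max; case/andP: (h1 w) => _ ->; case/andP: (h2 w).
    by move=> w; rewrite /W lt_max => /orP[/u1|/u2].
  split => w /= /le_trans; apply; rewrite lerD2l.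
    apply: (@le_trans _ _ (\sum_(n < N) W n w)).
      by apply: ler_sum => n _; rewrite /W le_max lexx.
    exact: (mono N (maxn N N') (fun n => W n w) (leq_maxl _ _) (fun n => W0 n w)).
  apply: (@le_trans _ _ (\sum_(n < N') W n w)).
    by apply: ler_sum => n _; rewrite /W le_max lexx orbT.
  exact: (mono N' (maxn N N') (fun n => W n w) (leq_maxr _ _) (fun n => W0 n w)).
- move=> w Kw; have [Pd|Pd] := ltP (Phi w) d.
    exists (0%N, fun _ _ => 0) => //.
    have dp : 0 < d - Phi w by rewrite subr_gt0.
    have := Cyl_continuous_sublevel rho_adm cP Kw dp.
    apply: filterS => w' h /h; rewrite /A /= big_ord0 addr0.
    move=> /(le_lt_trans (ler_norm _)); lra.
  have /PU[n _ Uw] : 0 < Phi w by exact: lt_le_trans Pd.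
  have [cS oS] := SP n; have [Psi [cQ Q01 QU Qw]] := oS _ Uw.
  have cQ0 : Cyl S0 Psi by apply: Cyl_sub cQ => t St; exists n.+1.
  (* The factor [2 / Psi w] makes [V'] equal to 1, hence at least [Phi], wherever [Psi] exceeds half
     its value at [w]. *)
  pose V' w' := Num.min 1 (2 / Psi w * Psi w').
  pose V (m : nat) (w' : X) := if m == n then V' w' else 0.
  have cV' : Cyl S0 V' by apply: Cyl_min => //; exact: CylZ.
  have V'0 w' : 0 <= V' w'.
    rewrite le_min ler01 /= mulr_ge0//; last by case/andP: (Q01 w').
    by rewrite divr_ge0// ltW.
  have V'01 w' : 0 <= V' w' <= 1 by rewrite V'0 ge_min lexx.
  have gV : good (n.+1, V).
    move=> m /=; rewrite /V; case: eqP => [->|_]; last exact: good0.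
    split => //; split => //; first exact: Cyl_sub cV'.
    move=> w'; rewrite lt_min => /andP[_].
    rewrite pmulr_rgt0 ?divr_gt0//; exact: QU.
  exists (n.+1, V) => //.
  have Qw2 : 0 < Psi w / 2 by rewrite divr_gt0.
  have := Cyl_continuous_sublevel rho_adm cQ Kw Qw2.
  apply: filterS => w' h /h {}h; rewrite /A /=.
  have V1 : V' w' = 1.
    apply/min_idPl; rewrite mulrAC ler_pdivlMr// mul1r.
    by move: h; rewrite ltr_norml; lra.
  rewrite big_ord_recr /= /V eqxx V1 (_ : \sum_(i < n) _ = 0); last first.
    by apply: big1 => i _; rewrite ltn_eqF.
  by have /andP[_] := P01 w'; lra.
exists N, V; split; first by move=> n; case: (gV n).
have cS : Cyl S0 (fun w => \sum_(n < N) V n w).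
  by apply: Cyl_sum => n; case: (gV n).
have cP0 : Cyl S0 Phi by exists F => // t tF; exists 0%N.
pose G w := d + \sum_(n < N) V n w.
have cG : Cyl S0 G by exact: CylD.
pose Th w := Num.max (Phi w - G w) 0.
have cTh : Cyl S0 Th by apply: Cyl_max => //; exact: CylB.
have [H HS0 cH] := cTh.
have LG : L G = d + \sum_(n < N) L (V n).
  rewrite (LD (S0cst d) cS) L_cst (@L_sum S0)// => k; by case: (gV k).
have LT : L Th <= d.
  apply: (@le_trans _ _ (\sum_(t <- undup H) K t / r t)).
    apply: L_tight => //.
    - by move=> t; case: (KP t).
    - by move=> t; case: (KP t).
    - exact: Cyl_sub cTh.
    - move=> w; rewrite le_max lexx orbT /= ge_max ler01 andbT.
      have : 0 <= G w.
        apply: addr_ge0; [exact: ltW|apply: sumr_ge0 => i _].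
        by have [_ [_ /(_ w)/andP[]]] := gV i.
      by have /andP[_] := P01 w; lra.
    - move=> w Hw.
      (* [KK] constrains every time, the hypothesis only those in [H]; the other coordinates, which
         [Th] does not see, are set to [point]. *)
      pose w' t := if t \in H then w t else point.
      rewrite (@cyl_eq _ _ _ _ _ _ w w' cH); last first.
        by move=> t tH; rewrite /w' tH.
      apply/max_idPr; rewrite subr_le0; apply: (KV w') => t.
      by rewrite /w'; case: ifP => // tH; rewrite Hw// mem_undup.
  apply: (@le_trans _ _ (\sum_(t <- undup H) d * 2^-1 ^+ (idx t).+1)).
    by apply: ler_sum => t _; exact: Kr.
  rewrite -mulr_sumr ger_pMr//.
  rewrite -(big_map idx xpredT (fun i => (2^-1 : R) ^+ i.+1)).
  apply: sum_half_uniq; rewrite map_inj_in_uniq ?undup_uniq//.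
  move=> t u; rewrite !mem_undup => /HS0 tS /HS0 uS; apply: idxP; exact/mem_set.
have : L Phi <= L (fun w => G w + Th w).
  by apply: (L_le cP0 (CylD cG cTh)) => w; rewrite -lerBlDl /Th le_max lexx.
rewrite (LD cG cTh) LG; move: LT; rewrite /d; lra.
Qed.

End outer.

(** * The path measure *)

Section path_measure.
Context {R : realType} {E : ptopologicalType} (rho : E -> R).
Hypothesis rho_adm : admissible_weight rho.
Hypothesis hE : hausdorff_space E.
Hypothesis crE : completely_regular_space E.
Variable P : R -> (E -> R) -> (E -> R).
Hypothesis fP : generalized_Feller rho P.
Hypothesis P1 : forall t : R, 0 <= t -> P t (fun _ => 1) = (fun _ => 1).
Variable nu : probability (Borel E) R.
Hypothesis nu_rho : (\int[nu]_x (rho x)%:E < +oo)%E.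

Local Notation T := {nonneg R}.
Local Notation X := (T -> E).
Local Notation Cyl := (Cyl (T := T) rho).
Local Notation L := (Lcyl rho P nu).
Local Notation below := (below rho).
Local Notation cyl_open := (cyl_open rho).
Local Notation cyl_copen := (cyl_copen rho).
Implicit Types (S : set T) (Phi Psi : X -> R) (w z : X) (s t u : T) (U V A : set X).

Definition lam U : \bar R := ereal_sup [set (L Phi)%:E | Phi in below U].

Lemma lam_ub U Phi : below U Phi -> ((L Phi)%:E <= lam U)%E.
Proof. by move=> bP; apply: ereal_sup_ubound; exists Phi. Qed.

Lemma below0 U : below U (fun=> 0).
Proof.
split; [exact: Cyl_cst|by move=> w; rewrite lexx ler01|by move=> w; rewrite ltxx].
Qed.

Lemma lam_ge0 U : (0 <= lam U)%E.
Proof.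
by have := lam_ub (below0 U); rewrite (L_cst rho_adm hE fP P1).
Qed.

Lemma lam_le1 U : (lam U <= 1)%E.
Proof.
apply: ge_ereal_sup => _ [Phi [cP P01 _] <-].
rewrite lee_fin -(L_cst rho_adm hE fP P1 nu 1).
apply: (L_le rho_adm hE fP P1 nu cP (Cyl_cst rho _ 1)) => w.
by case/andP: (P01 w).
Qed.

Lemma lam_mono U V : U `<=` V -> (lam U <= lam V)%E.
Proof.
move=> UV; apply: le_ereal_sup => _ [Phi [cP P01 PU] <-].
by exists Phi => //; split => // w /PU/UV.
Qed.

Lemma lam0 : lam set0 = 0%E.
Proof.
apply/le_anti; rewrite lam_ge0 andbT; apply: ge_ereal_sup => _ [Phi [cP P01 P0] <-].
rewrite (_ : Phi = (fun=> 0)) ?(L_cst rho_adm hE fP P1)//.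
apply/funext => w; apply/le_anti; case/andP: (P01 w) => -> _; rewrite andbT.
by rewrite leNgt; apply/negP => /P0.
Qed.

Lemma lamT : lam setT = 1%E.
Proof.
apply/le_anti; rewrite lam_le1 /=.
have b1 : below setT (fun=> 1).
  by split => // [|w]; [exact: Cyl_cst|rewrite ler01 lexx].
by have := lam_ub b1; rewrite (L_cst rho_adm hE fP P1).
Qed.

Lemma cyl_open_sub S S' U : S `<=` S' -> cyl_open S U -> cyl_open S' U.
Proof.
move=> SS' oU w /oU[Phi [cP P01 PU Pw]]; exists Phi; split => //.
exact: Cyl_sub cP.
Qed.

Lemma cyl_openI S U V : cyl_open S U -> cyl_open S V -> cyl_open S (U `&` V).
Proof.
move=> oU oV w [/oU[Phi [cP P01 PU Pw]] /oV[Psi [cQ Q01 QV Qw]]].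
exists (fun w => Num.min (Phi w) (Psi w)); split.
- exact: Cyl_min.
- move=> z; rewrite le_min ge_min; case/andP: (P01 z) => -> ->.
  by case/andP: (Q01 z) => ->.
- by move=> z; rewrite lt_min => /andP[/PU ? /QV].
- by rewrite lt_min Pw.
Qed.

Lemma cyl_copenI U V : cyl_copen U -> cyl_copen V -> cyl_copen (U `&` V).
Proof.
move=> [S cS oU] [S' cS' oV].
exists (\bigcup_n (if n is 0%N then S else S')).
  by apply: bigcup_countable => // -[|n].
apply: cyl_openI; first by apply: cyl_open_sub oU => t St; exists 0%N.
by apply: cyl_open_sub oV => t St; exists 1%N.
Qed.

Lemma cyl_copen_bigcup (U_ : nat -> set X) : (forall n, cyl_copen (U_ n)) ->
  cyl_copen (\bigcup_n U_ n).
Proof.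
move=> oU; have /choice[S_ SP] : forall n, exists S : set T, countable S /\ cyl_open S (U_ n).
  by move=> n; have [S ? ?] := oU n; exists S.
exists (\bigcup_n S_ n).
  by apply: bigcup_countable => // n _; case: (SP n).
move=> w [n _ /(SP n).2[Phi [cP P01 PU Pw]]]; exists Phi; split => //.
  by apply: Cyl_sub cP => t St; exists n.
by move=> z /PU Uz; exists n.
Qed.

Lemma cyl_open_gt S Phi a : Cyl S Phi -> cyl_open S [set w | a < Phi w].
Proof.
move=> cP w aw.
exists (fun w => Num.min 1 (Num.max (Phi w - a) 0)); split.
- apply: Cyl_min; first exact: Cyl_cst.
  by apply: Cyl_max; [apply: CylB => //|]; exact: Cyl_cst.
- by move=> z; rewrite le_min ler01 /= le_max lexx orbT ge_min lexx.
- by move=> z; rewrite lt_min lt_max ltxx orbF => /andP[_]; rewrite subr_gt0.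
- by rewrite lt_min ltr01 lt_max subr_gt0 aw.
Qed.

Lemma cyl_copen_gt S Phi a : Cyl S Phi -> cyl_copen [set w | a < Phi w].
Proof.
move=> [F _ cF]; exists [set` F]; first exact/finite_set_countable/finite_seq.
by apply: cyl_open_gt; exists F.
Qed.

Lemma cyl_copenT : cyl_copen setT.
Proof.
have := cyl_copen_gt 0 (Cyl_cst rho (T := T) setT 1).
by congr cyl_copen; apply/seteqP; split => w //= _; exact: ltr01.
Qed.

Lemma cyl_copen0 : cyl_copen set0.
Proof.
have := cyl_copen_gt 0 (Cyl_cst rho (T := T) setT 0).
by congr cyl_copen; apply/seteqP; split => w //=; rewrite ltxx.
Qed.

Lemma lam_bigcup (U_ : nat -> set X) : (forall n, cyl_copen (U_ n)) ->
  (lam (\bigcup_n U_ n) <= \sum_(n <oo) lam (U_ n))%E.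
Proof.
move=> oU; apply: ge_ereal_sup => _ [Phi bP <-]; apply/lee_addgt0Pr => e e0.
have [N [V [bV LV]]] := below_bigcup rho_adm hE fP P1 nu_rho oU bP e0.
apply: (@le_trans _ _ ((\sum_(n < N) L (V n))%:E + e%:E)%E).
  by rewrite -EFinD lee_fin.
rewrite leeD2r// -sumEFin.
apply: (@le_trans _ _ (\sum_(n < N) lam (U_ n))%E).
  by apply: lee_sum => n _; exact: lam_ub.
rewrite -(big_mkord xpredT (fun n => lam (U_ n))).
by apply: nneseries_lim_ge => n _ _; exact: lam_ge0.
Qed.

Definition omu A : \bar R :=
  ereal_inf [set lam U | U in [set U | cyl_copen U /\ A `<=` U]].

Lemma omu_le A U : cyl_copen U -> A `<=` U -> (omu A <= lam U)%E.
Proof. by move=> oU AU; apply: ereal_inf_lbound; exists U. Qed.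

Lemma omu_ge0 A : (0 <= omu A)%E.
Proof. by apply: le_ereal_inf_tmp => _ [U _ <-]; exact: lam_ge0. Qed.

Lemma omu_mono A B : A `<=` B -> (omu A <= omu B)%E.
Proof.
move=> AB; apply: ereal_inf_le_tmp => _ [U [oU BU] <-].
by exists U => //; split => //; exact: subset_trans BU.
Qed.

Lemma omuE U : cyl_copen U -> omu U = lam U.
Proof.
move=> oU; apply/le_anti; rewrite omu_le//=.
by apply: le_ereal_inf_tmp => _ [V [_ UV] <-]; exact: lam_mono.
Qed.

Lemma omu_fin A : omu A \is a fin_num.
Proof.
rewrite ge0_fin_numE ?omu_ge0// (@le_lt_trans _ _ 1%E) ?ltry//.
by rewrite -lamT omu_le//; exact: cyl_copenT.
Qed.

Lemma lam_fin U : lam U \is a fin_num.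
Proof.
by rewrite ge0_fin_numE ?lam_ge0// (@le_lt_trans _ _ 1%E) ?ltry// lam_le1.
Qed.

Lemma omu0 : omu set0 = 0%E.
Proof. by rewrite omuE ?lam0//; exact: cyl_copen0. Qed.

Lemma omu_sigma_subadditive : sigma_subadditive omu.
Proof.
move=> A; apply/lee_addgt0Pr => e e0.
have /choice[U UP] : forall n, exists U, [/\ cyl_copen U, A n `<=` U &
    (lam U <= omu (A n) + (e / (2 ^ n.+1)%:R)%:E)%E].
  move=> n; have en : 0 < e / (2 ^ n.+1)%:R by rewrite divr_gt0// ltr0n expn_gt0.
  have [_ [U [oU AU] <-] Ul] := lb_ereal_inf_adherent en (omu_fin (A n)).
  by exists U; split => //; exact: ltW.
apply: (le_trans _ (epsilon_trick xpredT (fun n => omu_ge0 (A n)) (ltW e0))).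
apply: (@le_trans _ _ (lam (\bigcup_n U n))).
  apply: omu_le; first by apply: cyl_copen_bigcup => n; case: (UP n).
  by apply: subset_bigcup => n _; case: (UP n).
apply: (@le_trans _ _ (\sum_(n <oo) lam (U n))%E).
  by apply: lam_bigcup => n; case: (UP n).
by apply: lee_nneseries => n *; [exact: lam_ge0|case: (UP n)].
Qed.

Definition path_outer : {outer_measure set X -> \bar R} :=
  HB.pack omu (isOuterMeasure.Build R X omu omu0 omu_ge0 omu_mono
    omu_sigma_subadditive).

(** Given [Phi] below the intersection of [U] and [V], the set [W] of paths in [U] with [Phi < d] is
    open and covers [A] minus [V]. If [Psi] is below [W], then [(Phi - d)^+] and [Psi] are never
    positive together, so their sum is below [U]; thus [L Phi + lam W <= lam U + d]. *)
Lemma cyl_copen_caratheodory V : cyl_copen V -> path_outer.-caratheodory V.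
Proof.
move=> oV; apply: le_caratheodory_measurable => A /=.
apply: le_ereal_inf_tmp => _ [U [oU AU] <-].
apply: (@le_trans _ _ (lam (U `&` V) + omu (A `&` ~` V))%E).
  rewrite leeD2r//; apply: omu_le; first exact: cyl_copenI.
  exact: setSI.
rewrite -leeBrDr ?omu_fin//; apply: ge_ereal_sup => _ [Phi bP <-].
rewrite leeBrDr ?omu_fin//; apply/lee_addgt0Pr => d d0.
have [cP P01 PUV] := bP.
pose W := U `&` [set w | -d < - Phi w].
have cNP : Cyl setT (fun w => -1 * Phi w) by exact: CylZ.
have oW : cyl_copen W.
  apply: cyl_copenI => //; have := cyl_copen_gt (- d) cNP.
  by congr cyl_copen; apply/seteqP; split => w /=; rewrite mulN1r.
have AW : A `&` ~` V `<=` W.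
  move=> w [Aw nVw]; split; first exact: AU.
  rewrite /= ltrN2 (le_lt_trans _ d0)// leNgt.
  by apply/negP => /PUV[].
apply: (@le_trans _ _ ((L Phi)%:E + lam W)%E).
  by rewrite leeD2l// omu_le.
rewrite addeC -leeBrDr//; apply: ge_ereal_sup => _ [Psi bQ <-].
rewrite leeBrDr// -EFinD.
have [cQ Q01 QW] := bQ.
pose Th w := Num.max (Phi w - d) 0 + Psi w.
have cM : Cyl setT (fun w => Num.max (Phi w - d) 0).
  by apply: Cyl_max; [apply: CylB => //|]; exact: Cyl_cst.
have bT : below U Th.
  split; first exact: CylD.
  - move=> w; have /andP[p0 p1] := P01 w; have /andP[q0 q1] := Q01 w.
    have [pd|pd] := leP (Phi w) d.
      by rewrite /Th (max_idPr _) ?subr_le0// add0r q0 q1.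
    have -> : Th w = Phi w - d.
      rewrite /Th (max_idPl _) ?subr_ge0 1?ltW//.
      suff -> : Psi w = 0 by rewrite addr0.
      apply/le_anti; rewrite q0 andbT leNgt; apply/negP => /QW[_] /=.
      by rewrite ltrN2 ltNge ltW.
    by apply/andP; split; lra.
  - move=> w; have [/QW[]//|q0] := ltP 0 (Psi w).
    rewrite /Th => h; have : 0 < Num.max (Phi w - d) 0 by lra.
    rewrite lt_max ltxx orbF => h'.
    by have /PUV[] : 0 < Phi w by lra.
apply: (@le_trans _ _ ((L Th)%:E + d%:E)%E); last by rewrite leeD2r// lam_ub.
rewrite -EFinD lee_fin (LD rho_adm hE fP P1 nu cM cQ).
have : L Phi - d <= L (fun w => Num.max (Phi w - d) 0).
  rewrite -{1}(L_cst rho_adm hE fP P1 nu d).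
  rewrite -(LB rho_adm hE fP P1 nu cP (Cyl_cst rho _ d)).
  apply: (L_le rho_adm hE fP P1 nu (CylB cP (Cyl_cst rho _ d)) cM) => w.
  by rewrite le_max lexx.
lra.
Qed.

(** Complete regularity enters through this separation: it makes one-time preimages of open sets
    open in the sense of [cyl_open]. *)
Lemma Cb_separation (V : set E) x : open V -> V x -> exists f : E -> R,
  [/\ Cb f, forall y, 0 <= f y <= 1, forall y, 0 < f y -> V y & f x = 1].
Proof.
move=> oV Vx.
have cV : closed (~` V) by exact: open_closedC.
have nV : ~ (~` V) x by move=> /(_ Vx).
have /(@uniform_separatorP _ R)[f [cf f01 f0 f1]] := crE cV nV.
have f01' y : 0 <= f y <= 1.
  by have := f01 _ (imageP f (I : setT y)); rewrite /= in_itv.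
exists (fun y => 1 + -1 * f y); split.
- apply: (CbD (Cb_cst 1) (CbM (Cb_cst (-1)) _)); split => //; exists 1 => y.
  by case/andP: (f01' y) => ? ?; rewrite ger0_norm.
- by move=> y; have := f01' y; lra.
- move=> y; apply: contraPP => /= nVy; have -> : f y = 1.
    by apply: f1; exists y.
  by rewrite mulr1 subrr ltxx.
- have -> : f x = 0 by apply: f0; exists x.
  by rewrite mulr0 addr0.
Qed.

Lemma cyl_open_coord t (V : set E) : open V ->
  cyl_open [set t] [set w | V (w t)].
Proof.
move=> oV w Vw; have [f [cf f01 fV f1]] := Cb_separation oV Vw.
exists (fun w => f (w t)); split => //.
- by apply: Cyl_coord => //; exact: bBrho_Cb.
- by move=> z /fV.
- by rewrite f1.
Qed.

Lemma Path_measurable_caratheodory :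
  (measurable : set (set (Path R E))) `<=` path_outer.-caratheodory.
Proof.
have sM : sigma_algebra setT (path_outer.-caratheodory).
  split.
  - exact: caratheodory_measurable_set0.
  - by move=> A; rewrite setTD; exact: caratheodory_measurable_setC.
  - by move=> A; exact: caratheodory_measurable_bigcup.
apply: smallest_sub => // _ [t [B [mB ->]]].
suff : <<s @open E >> `<=` [set B | path_outer.-caratheodory ((fun w : X => w t) @^-1` B)].
  by move=> h; exact: (h B mB).
apply: smallest_sub; last first.
  move=> V oV; apply: cyl_copen_caratheodory; exists [set t].
    exact: countable1.
  exact: cyl_open_coord.
case: sM => s0 sC sU; split.
- by rewrite /= preimage_set0.
- by move=> A /sC /=; rewrite !setTD preimage_setC.
- by move=> A mA /=; rewrite preimage_bigcup; exact: sU.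
Qed.

Definition pmu (A : set (Path R E)) : \bar R := omu A.

Let pmu_sigma_additive : semi_sigma_additive pmu.
Proof.
move=> A mA tA mUA.
apply: (@caratheodory_measure_sigma_additive R (Path R E) path_outer A) => //.
  by move=> n; exact: Path_measurable_caratheodory (mA n).
exact: Path_measurable_caratheodory mUA.
Qed.

HB.instance Definition _ :=
  isMeasure.Build _ _ _ pmu omu0 omu_ge0 pmu_sigma_additive.

Let pmuT : pmu setT = 1%E.
Proof. by rewrite /pmu omuE ?lamT//; exact: cyl_copenT. Qed.

HB.instance Definition _ := Measure_isProbability.Build _ _ _ pmu pmuT.

(** Everything afterwards uses the measure only through its values on open sets. *)
Lemma path_probability_exists : exists Q : probability (Path R E) R,
  forall U : set (Path R E), cyl_copen U -> Q U = lam U.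
Proof. by exists pmu => U oU; rewrite -omuE. Qed.

End path_measure.

(** * Expectations, initial law and Markov property *)

(** The measurable sets of zero charge, for the charge with density [h], form a Dynkin system; the
    complement step uses [G setT], that is, total charge zero. *)
Lemma integral_eq0_pi_system {R : realType} (d : measure_display) (T : measurableType d)
    (mu : {measure set T -> \bar R}) (h : T -> R) (G : set (set T)) :
  mu.-integrable setT (EFin \o h) -> G `<=` measurable -> setI_closed G -> G setT ->
  (forall A, G A -> (\int[mu]_(x in A) (h x)%:E = 0)%E) ->
  forall A, <<s G >> A -> (\int[mu]_(x in A) (h x)%:E = 0)%E.
Proof.
move=> ih Gm GI GT G0.
pose c : {charge set T -> \bar R} := induced_charge ih.
suff H : <<s G >> `<=` [set A | measurable A /\ c A = 0%E].
  by move=> A /H[].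
rewrite -(setI_closed_g_dynkin_g_sigma_algebra GI).
apply: smallest_sub; last by move=> A GA; split; [exact: Gm|exact: G0].
split.
- by split; [exact: measurableT|exact: G0].
- move=> A [mA cA]; split; first exact: measurableC.
  rewrite -setTD chargeD// setTI cA sube0; exact: G0.
- move=> F tF F0.
  have mF n : measurable (F n) by case: (F0 n).
  have mUF : measurable (\bigcup_n F n) by exact: bigcupT_measurable.
  split => //; have := @charge_semi_sigma_additive _ _ _ c F mF tF mUF.
  rewrite (_ : (fun n => _) = cst 0%E).
    by move=> /cvg_lim <-//; rewrite lim_cst.
  by apply/funext => n; apply: big1 => i _; case: (F0 i).
Qed.

Section clamp.
Context {R : realType}.

Definition clamp (x : R) : R := Num.min 1 (Num.max x 0).

Lemma clamp01 x : 0 <= clamp x <= 1.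
Proof. by rewrite /clamp le_min ler01 /= le_max lexx orbT ge_min lexx. Qed.

Lemma clamp_gt0 x : 0 < clamp x -> 0 < x.
Proof. by rewrite /clamp lt_min lt_max ltxx orbF => /andP[]. Qed.

Lemma clamp_ge1 x : 1 <= x -> clamp x = 1.
Proof. by move=> x1; apply/min_idPl; rewrite le_max x1. Qed.

(** Cutting [[0, n]] into unit layers: the term of index [k] is the part of [x] between [k] and
    [k + 1]. *)
Lemma sum_clamp n x : 0 <= x <= n%:R -> \sum_(k < n) clamp (x - k%:R) = x.
Proof.
elim: n x => [|n ih] x /andP[x0 xn].
  by rewrite big_ord0; apply/le_anti; rewrite x0 xn.
have [xn'|nx] := leP x n%:R.
  rewrite big_ord_recr /= ih ?x0// (_ : clamp _ = 0) ?addr0//.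
  rewrite /clamp (max_idPr _) ?subr_le0//; apply/min_idPr; exact: ler01.
rewrite big_ord_recr /= [X in X + _](_ : _ = n%:R); last first.
  rewrite (eq_bigr (fun=> 1)) => [|k _].
    by rewrite sumr_const card_ord.
  apply: clamp_ge1; rewrite lerBrDl natr1 (le_trans _ (ltW nx))// ler_nat//.
rewrite /clamp (max_idPl _) ?subr_ge0 1?ltW//.
rewrite (min_idPr _) ?[n%:R + _]addrC ?subrK// lerBlDl.
by move: xn; rewrite -natr1.
Qed.

End clamp.

Section path_expectation.
Context {R : realType} {E : ptopologicalType} (rho : E -> R).
Hypothesis rho_adm : admissible_weight rho.
Hypothesis hE : hausdorff_space E.
Hypothesis crE : completely_regular_space E.
Variable P : R -> (E -> R) -> (E -> R).
Hypothesis fP : generalized_Feller rho P.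
Hypothesis P1 : forall t : R, 0 <= t -> P t (fun _ => 1) = (fun _ => 1).
Variable nu : probability (Borel E) R.
Variable Q : probability (Path R E) R.

Local Notation T := {nonneg R}.
Local Notation X := (Path R E).
Local Notation Cyl := (Cyl (T := T) rho).
Local Notation L := (Lcyl rho P nu).
Local Notation lam := (lam rho P nu).
Local Notation below := (below rho).
Local Notation cyl_open := (cyl_open rho).
Local Notation cyl_copen := (cyl_copen rho).
Hypothesis QU : forall U : set X, cyl_copen U -> Q U = lam U.
Implicit Types (S : set T) (Phi Psi : X -> R) (w z : X) (s t u : T) (U V A : set X).

Lemma coord_measurable t : measurable_fun setT (fun w : X => w t : Borel E).
Proof.
by move=> _ B mB; rewrite setTI; apply: sub_sigma_algebra; exists t, B.
Qed.

Lemma Brho_coord_measurable t f : Brho rho f ->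
  measurable_fun setT (fun w : X => f (w t)).
Proof.
move=> bf; have mf := Brho_measurable rho_adm bf.
exact: (measurableT_comp (mf : measurable_fun setT (f : Borel E -> R)) (coord_measurable t)).
Qed.

Lemma Cyl_measurable S Phi : Cyl S Phi -> measurable_fun setT (Phi : X -> R).
Proof.
move=> [F _]; elim=> {Phi}.
- by move=> a; exact: measurable_cst.
- move=> t f Phi _ [bf _] _ ih.
  by apply: measurable_funM => //; exact: Brho_coord_measurable.
- by move=> Phi Psi _ h _ k; exact: measurable_funD.
- move=> Phi Psi_ _ ih h.
  apply: (@measurable_fun_cvg _ X _ setT Psi_) => // w _.
  apply/cvgrPdist_le => e e0; exists (Num.truncn e^-1) => // n /= hn.
  rewrite (le_trans (h n w))// -[leRHS]invrK lef_pV2 ?posrE ?invr_gt0// ltW//.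
  by rewrite -truncn_le_nat.
Qed.

Lemma Cyl_integrable S Phi : Cyl S Phi -> Q.-integrable setT (EFin \o (Phi : X -> R)).
Proof.
move=> cP; have [F _ cF] := cP; have [M PM] := cyl_bounded cF.
exact: bounded_integrable (Cyl_measurable cP) PM.
Qed.

Let L_cst := L_cst rho_adm hE fP P1 nu.
Let LB := LB rho_adm hE fP P1 nu.
Let LZ := LZ rho_adm hE fP P1 nu.
Let L_le := L_le rho_adm hE fP P1 nu.
Let L_sum := L_sum rho_adm hE fP P1 nu.

Lemma expect_sum S (Phi_ : nat -> X -> R) n : (forall k, Cyl S (Phi_ k)) ->
  \int[Q]_w (\sum_(k < n) Phi_ k w) = \sum_(k < n) \int[Q]_w Phi_ k w.
Proof.
move=> h; elim: n => [|n ih].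
  rewrite big_ord0 /Rintegral (_ : (\int[Q]_w _)%E = 0%E)//.
  by apply: integral0_eq => w _; rewrite big_ord0.
rewrite big_ord_recr /= -ih -RintegralD//.
- by apply: eq_Rintegral => w _; rewrite big_ord_recr.
- exact: (Cyl_integrable (Cyl_sum n h)).
- exact: (Cyl_integrable (h n)).
Qed.

(* Layer cake: with [Phi_ k = clamp (n Phi - k)] one has
   [L (Phi_ k.+1) <= Q (n Phi > k.+1) <= E (Phi_ k)], and [n Phi = sum_k Phi_ k]. *)
Lemma expect_ge S Phi : Cyl S Phi -> (forall w, 0 <= Phi w <= 1) ->
  L Phi <= \int[Q]_w Phi w.
Proof.
move=> cP P01; apply/ler_addgt0Pr => e e0.
pose n := (Num.truncn e^-1).+1.
have n0 : 0 < n%:R :> R by rewrite ltr0n.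
have ne : n%:R^-1 <= e.
  rewrite -[leRHS]invrK lef_pV2 ?posrE ?invr_gt0// ltW//.
  by rewrite -truncn_le_nat.
pose Phi_ k w := clamp (n%:R * Phi w - k%:R).
have cP_ k : Cyl S (Phi_ k).
  apply: Cyl_min; first exact: Cyl_cst.
  by apply: Cyl_max; [apply: CylB; [exact: CylZ|]|]; exact: Cyl_cst.
have sumP w : \sum_(k < n) Phi_ k w = n%:R * Phi w.
  by apply: sum_clamp; have /andP[p0 p1] := P01 w; rewrite mulr_ge0//= ger_pMr.
have step k : L (Phi_ k.+1) <= \int[Q]_w Phi_ k w.
  pose U := [set w : X | 0 < n%:R * Phi w - k.+1%:R].
  have cPk : Cyl S (fun w => n%:R * Phi w - k.+1%:R).
    by apply: CylB; [exact: CylZ|exact: Cyl_cst].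
  have oU : cyl_copen U by exact: cyl_copen_gt cPk.
  have mU : measurable U.
    rewrite [U](_ : _ = (fun w => n%:R * Phi w - k.+1%:R) @^-1` `]0, +oo[%classic).
      rewrite -[X in measurable X]setTI; apply: (Cyl_measurable cPk) => //.
    by apply/seteqP; split => w /=; rewrite in_itv/= andbT.
  have bU : below U (Phi_ k.+1).
    split; [exact: Cyl_sub (cP_ _)|by move=> w; exact: clamp01|].
    by move=> w; exact: clamp_gt0.
  rewrite -lee_fin (le_trans (lam_ub P nu bU))// -QU//.
  rewrite /Rintegral fineK; last exact: integrable_fin_num (Cyl_integrable (cP_ k)).
  rewrite -[leLHS](_ : (\int[Q]_w (\1_U w)%:E = _)%E); last by rewrite integral_indic// setIT.
  apply: ge0_le_integral => //.
  - by apply/measurable_EFinP; exact: measurable_indic.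
  - by apply/measurable_EFinP; exact: Cyl_measurable (cP_ k).
  - move=> w _; rewrite lee_fin indicE.
    have [/set_mem Uw|_] := boolP (w \in U); last first.
      by case/andP: (clamp01 (n%:R * Phi w - k%:R)).
    rewrite /Phi_ clamp_ge1//; move: Uw; rewrite /U /= -natr1; lra.
have h1 : n%:R * L Phi = \sum_(k < n) L (Phi_ k).
  rewrite -(LZ _ cP) -(L_sum n cP_); congr L; apply/funext => w.
  by rewrite sumP.
have h2 : n%:R * (\int[Q]_w Phi w) = \sum_(k < n) \int[Q]_w Phi_ k w.
  rewrite -RintegralZl//; last exact: Cyl_integrable cP.
  rewrite -(expect_sum n cP_); apply: eq_Rintegral => w _.
  by rewrite sumP.
(* The shift of index loses only the layer [k = 0], worth at most 1, hence at most [1 / n <= e]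
   after division by [n]. *)
have h3 : \sum_(k < n) L (Phi_ k) <= 1 + \sum_(k < n) L (Phi_ k.+1).
  rewrite [leLHS]big_ord_recl /= lerD//.
    rewrite -(L_cst 1); apply: (L_le (cP_ 0%N) (Cyl_cst rho _ 1)) => w.
    by case/andP: (clamp01 (n%:R * Phi w - 0%:R)).
  rewrite big_ord_recr /= lerDl; apply: (L_ge0 rho_adm hE fP P1 nu (cP_ _)) => w.
  by case/andP: (clamp01 (n%:R * Phi w - n%:R)).
have h4 : \sum_(k < n) L (Phi_ k.+1) <= \sum_(k < n) \int[Q]_w Phi_ k w.
  by apply: ler_sum => k _; exact: step.
have h5 : n%:R * L Phi <= n%:R * (\int[Q]_w Phi w + n%:R^-1).
  rewrite mulrDr divff ?gt_eqF// h2 h1; lra.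
move: h5; rewrite ler_pM2l// => /le_trans; apply; exact: lerD.
Qed.

(** Applying [expect_ge] to [Phi] and to [1 - Phi] gives equality for values in [[0, 1]]; a bounded
    [Phi] is brought there by an affine change. *)
Lemma expectE S Phi : Cyl S Phi -> \int[Q]_w Phi w = L Phi.
Proof.
have QT : Q setT = 1%E by exact: probability_setT.
have Ecst a : \int[Q]_w (cst a w) = a.
  transitivity (a * fine (Q setT)); first exact: Rintegral_cst.
  by rewrite QT mulr1.
have icst a : Q.-integrable setT (EFin \o (cst a : X -> R)).
  exact: finite_measure_integrable_cst.
have E01 Psi : Cyl S Psi -> (forall w, 0 <= Psi w <= 1) -> \int[Q]_w Psi w = L Psi.
  move=> cQ Q01; apply/le_anti; rewrite (expect_ge cQ)// andbT.
  have cQ' := CylB (Cyl_cst rho S 1) cQ.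
  have := expect_ge cQ' (fun w => ltac:(have := Q01 w; lra)).
  rewrite (LB (Cyl_cst rho S 1) cQ) L_cst.
  rewrite (RintegralB _ (icst 1) (Cyl_integrable cQ))// Ecst; lra.
move=> cP; have [F _ cF] := cP; have [M PM] := cyl_bounded cF.
have M0 : 0 <= M by exact: le_trans (PM (fun=> point)).
pose c := 2 * (M + 1); have c0 : 0 < c by rewrite /c; lra.
pose Psi w := c^-1 * (Phi w + (M + 1)).
have cQ : Cyl S Psi by apply/CylZ/CylD => //; exact: Cyl_cst.
have Q01 w : 0 <= Psi w <= 1.
  have := PM w; rewrite ler_norml /Psi => /andP[h1 h2].
  apply/andP; split.
    by apply: mulr_ge0; [rewrite invr_ge0 ltW|lra].
  by rewrite mulrC ler_pdivrMr// /c; lra.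
have PQ : Phi = (fun w => c * Psi w - (M + 1)).
  by apply/funext => w; rewrite /Psi mulrA divff ?gt_eqF//; ring.
rewrite PQ (LB (CylZ c cQ) (Cyl_cst rho S (M + 1))) (LZ c cQ) L_cst.
rewrite (RintegralB _ (Cyl_integrable (CylZ c cQ)) (icst (M + 1)))//.
by rewrite (RintegralZl _ _ (Cyl_integrable cQ))// E01// Ecst.
Qed.

(** [Psi] is the supremum of [Phi] over the coordinates outside [S]. It is still positive only on
    [U], because membership of a spliced path in [U] is witnessed by a function that sees [S]
    alone. *)
Lemma below_restrict S U Phi : cyl_open S U -> below U Phi ->
  exists2 Psi, Cyl S Psi /\ below U Psi & forall w, Phi w <= Psi w.
Proof.
move=> oU [[F _ cF] P01 PU]; pose J : pred T := fun t => `[< S t >].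
pose Psi w := sup [set Phi (splice J w z) | z in setT].
have ub w : has_ubound [set Phi (splice J w z) | z in setT].
  by exists 1 => _ [z _ <-]; case/andP: (P01 (splice J w z)).
have PPsi w : Phi w <= Psi w.
  apply: ub_le_sup => //; exists w => //; congr Phi.
  by apply/funext => t; rewrite /splice; case: ifP.
have cPsi : Cyl S Psi.
  exists [seq t <- F | J t].
    by move=> t; rewrite mem_filter => /andP[/asboolP].
  by apply: cyl_sup cF _ => //; exists (fun=> point).
exists Psi => //; split => //; split.
- exact: Cyl_sub cPsi.
- move=> w; rewrite (le_trans _ (PPsi w))/=; last by case/andP: (P01 w).
  apply: ge_sup; first by exists (Phi (splice J w point)), point.
  by move=> _ [z _ <-]; case/andP: (P01 (splice J w z)).
- move=> w Pw.
  have [_ [z _ <-] Pz] : exists2 x, [set Phi (splice J w z) | z in setT] x & 0 < x.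
    by apply: sup_gt => //; exists (Phi (splice J w point)), point.
  have /oU[Th [[G GS cG] T01 TU Tz]] := PU _ Pz.
  apply: TU; rewrite (_ : Th w = Th (splice J w z))//.
  apply: cyl_eq cG _ => t /GS St; rewrite /splice.
  by have -> : J t by exact/asboolP.
Qed.

Lemma Cyl_diag S Phi : Cyl S Phi -> bBrho rho (fun y => Phi (fun=> y)).
Proof.
move=> [F _ cF]; exact: (cyl_bBrho rho_adm hE xpredT (fun=> point) cF).
Qed.

Lemma L_diag0 Phi : Cyl [set 0%:nng] Phi -> L Phi = \int[nu]_x Phi (fun=> x).
Proof.
move=> cP; have bP := Cyl_diag cP; have [F F0 cF] := cP.
rewrite -(Lcyl0 rho_adm hE fP P1 nu bP); congr L; apply/funext => w.
by apply: cyl_eq cF _ => t /F0 ->.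
Qed.

(** On an open [V], [below_restrict] brings approximants to time 0, giving one inequality. The other
    needs functions below [V] whose integrals reach [nu V]; since [V] may be an uncountable union of
    sets [f > 0], this rests on inner regularity by compact sets. *)
Lemma initial_law (B : set (Borel E)) :
  (forall A : set (Borel E), measurable A ->
     nu A = ereal_sup [set nu K | K in [set K : set (Borel E) |
                                         @compact E K /\ K `<=` A]]) ->
  measurable B -> Q (canon_proc 0%:nng @^-1` B) = nu B.
Proof.
move=> nu_reg mB; set z : T := 0%:nng.
have mc : measurable_fun setT (canon_proc z : X -> Borel E).
  exact: coord_measurable.
have opm : @open E `<=` (measurable : set (set (Borel E))).
  exact: sub_sigma_algebra.
suff om (V : set E) : open V -> Q (canon_proc z @^-1` V) = nu V.
  apply: (@g_sigma_algebra_measure_unique _ _ (Borel E) (@open E) opm (fun=> setT)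
    _ _ (pushforward Q (canon_proc z : X -> Borel E)) nu) => //.
  - by move=> _; exact: openT.
  - by rewrite bigcup_const.
  - by move=> A C; exact: openI.
  - move=> _; rewrite /= /pushforward preimage_setT.
    by rewrite (le_lt_trans (probability_le1 _ _))// ltry.
move=> oV; have oU : cyl_open [set z] [set w : X | V (w z)].
  exact: cyl_open_coord.
rewrite [LHS](QU (U := [set w : X | V (w z)])); last first.
  by exists [set z] => //; exact: countable1.
have mV := opm V oV.
apply/le_anti/andP; split.
  apply: ge_ereal_sup => _ [Phi bP <-].
  have [Psi [cQ [_ Q01 QV]] PQ] := below_restrict oU bP.
  have [cP _ _] := bP; have cQ' : Cyl setT Psi by exact: Cyl_sub cQ.
  apply: (@le_trans _ _ (L Psi)%:E); first by rewrite lee_fin; exact: L_le cP cQ' PQ.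
  rewrite L_diag0// /Rintegral fineK; last first.
    by apply: integrable_fin_num => //; exact: (bBrho_integrable rho_adm nu (Cyl_diag cQ)).
  rewrite -[leRHS](_ : (\int[nu]_x (\1_V x)%:E = _)%E); last first.
    by rewrite integral_indic// setIT.
  apply: ge0_le_integral => //.
  - by move=> x _; rewrite lee_fin; case/andP: (Q01 (fun=> x)).
  - by apply/measurable_EFinP; apply: (Brho_measurable rho_adm); case: (Cyl_diag cQ).
  - by apply/measurable_EFinP; exact: measurable_indic.
  - move=> x _; rewrite lee_fin indicE; have [_|/negP xV] := boolP (x \in V).
      by case/andP: (Q01 (fun=> x)).
    rewrite leNgt; apply/negP => /QV /= Vx; apply: xV; exact/mem_set.
rewrite (nu_reg _ mV); apply: ge_ereal_sup => _ [K [cK KV] <-].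
have [||x Kx|f [cf f0 fV] Kf] := @compact_directed_cover E (E -> R) K
    [set f | [/\ Cb f, forall y, 0 <= f y & forall y, 0 < f y -> V y]]
    (fun f => [set y | 1 <= f y]) cK.
- exists (fun=> 0); split => //; first exact: Cb_cst.
  by move=> y; rewrite ltxx.
- move=> f g [cf f0 fV] [cg g0 gV]; exists (fun y => Num.max (f y) (g y)); last first.
    by split => y /= h; rewrite le_max h ?orbT.
  split; first exact: Cb_max.
    by move=> y; rewrite le_max f0.
  by move=> y; rewrite lt_max => /orP[/fV|/gV].
- have [g [cg g01 gV g1]] := Cb_separation (R := R) crE oV (KV _ Kx).
  (* Doubling turns [g x = 1] into [2 * g y >= 1] on a whole neighbourhood of [x]. *)
  exists (fun y => 2 * g y).
    split; first exact: (CbM (Cb_cst 2) cg).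
      by move=> y; rewrite mulr_ge0//; case/andP: (g01 y).
    by move=> y; rewrite pmulr_rgt0//; exact: gV.
  have [/(_ x)/cvgrPdist_lt/(_ (2^-1))] := cg.
  rewrite invr_gt0 => /(_ (ltr0n _ 2)) + _; apply: filterS => y h _ /=.
  by move: h; rewrite g1 ltr_norml; lra.
pose Phi (w : X) := Num.min 1 (f (w z)).
have cP : Cyl [set z] Phi.
  apply: Cyl_min; first exact: Cyl_cst.
  by apply: Cyl_coord => //; exact: bBrho_Cb.
have P01 w : 0 <= Phi w <= 1 by rewrite le_min ler01 f0 ge_min lexx.
have bP : below [set w : X | V (w z)] Phi.
  split => //; first exact: Cyl_sub cP.
  by move=> w; rewrite lt_min => /andP[_ /fV].
apply: le_trans (lam_ub P nu bP); rewrite L_diag0// /Rintegral fineK; last first.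
  by apply: integrable_fin_num => //; exact: (bBrho_integrable rho_adm nu (Cyl_diag cP)).
have mK : measurable (K : set (Borel E)).
  rewrite -[K]setCK; apply: measurableC; apply: sub_sigma_algebra.
  exact: closed_openC (compact_closed hE cK).
rewrite -[leLHS](_ : (\int[nu]_x (\1_K x)%:E = _)%E); last first.
  by rewrite integral_indic// setIT.
apply: ge0_le_integral => //.
- by apply/measurable_EFinP; exact: measurable_indic.
- by apply/measurable_EFinP; apply: (Brho_measurable rho_adm); case: (Cyl_diag cP).
- move=> x _; rewrite lee_fin indicE; have [/set_mem/Kf Kx|_] := boolP (x \in K).
    by rewrite /Phi le_min lexx.
  by case/andP: (P01 (fun=> x)).
Qed.

Lemma Cyl_markov s t f Phi : leT s t -> bBrho rho f -> Cyl [set u | leT u s] Phi ->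
  \int[Q]_w ((f (w t) - P (t%:num - s%:num) f (w s)) * Phi w) = 0.
Proof.
move=> st bf cP.
have d0 : 0 <= t%:num - s%:num by rewrite subr_ge0.
have bPf := feller_bBrho rho_adm hE fP P1 d0 bf.
have cP' : Cyl setT Phi by exact: Cyl_sub cP.
have c1 : Cyl setT (fun w => f (w t) * Phi w) by apply: CylM => //; exact: Cyl_coord.
have c2 : Cyl setT (fun w => P (t%:num - s%:num) f (w s) * Phi w).
  by apply: CylM => //; apply: (Cyl_coord _ bPf).
transitivity (\int[Q]_w (f (w t) * Phi w - P (t%:num - s%:num) f (w s) * Phi w)).
  by apply: eq_Rintegral => w _; rewrite mulrBl.
rewrite (expectE (CylB c1 c2)) (LB c1 c2); apply/eqP; rewrite subr_eq0; apply/eqP.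
have [F FS cF] := cP.
exact: (Lcyl_markov rho_adm hE fP P1 nu cF FS st bf).
Qed.

(** [below_restrict] puts the approximant of the indicator of [U] at times up to [s], where
    [Cyl_markov] applies; [Q U = lam U] turns the gap into an [L^1] error, multiplied by the bound
    [M] of the integrand. *)
Lemma markov_cyl_open S s t f U : leT s t -> bBrho rho f -> measurable U ->
  countable S -> S `<=` [set u | leT u s] -> cyl_open S U ->
  (\int[Q]_(w in U) (f (w t) - P (t%:num - s%:num) f (w s))%:E = 0)%E.
Proof.
move=> st bf mU cS Ss oU; set d := t%:num - s%:num.
have d0 : 0 <= d by rewrite subr_ge0.
have bPf := feller_bBrho rho_adm hE fP P1 d0 bf.
pose h (w : X) := f (w t) - P d f (w s).
have ch : Cyl setT h by apply: CylB; [exact: Cyl_coord|apply: (Cyl_coord _ bPf)].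
have [F _ cF] := ch; have [M hM] := cyl_bounded cF.
have M0 : 0 <= M by exact: le_trans (hM (fun=> point)).
have ih := Cyl_integrable ch.
have ihU : Q.-integrable U (EFin \o h) by exact: integrableS ih.
suff : \int[Q]_(w in U) h w = 0.
  by move=> h0; rewrite -[LHS]fineK ?[fine _]h0//; exact: integrable_fin_num.
apply/eqP; rewrite -normr_le0; apply/ler_addgt0Pr => e e0; rewrite add0r.
have M1 : 0 < M + 1 by lra.
have eM : 0 < e / (M + 1) by rewrite divr_gt0.
have [_ [Phi bP <-] LP] := @ub_ereal_sup_adherent _ [set (L Phi)%:E | Phi in below U] _ eM
  (lam_fin rho_adm hE fP P1 nu U).
have [Psi [cQ bQ] PQ] := below_restrict oU bP.
have {bQ} [cQ' Q01 QV] := bQ; have [cP _ _] := bP.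
have LQ : fine (Q U) - L Psi <= e / (M + 1).
  have LPQ : L Phi <= L Psi by exact: L_le cP cQ' PQ.
  move: LP; rewrite -/(lam U) -QU; last by exists S.
  by rewrite -[Q U]fineK ?fin_num_measure// -EFinB lte_fin /=; lra.
have i1 : Q.-integrable setT (EFin \o (\1_U : X -> R)).
  apply: (@bounded_integrable _ _ _ _ _ 1); first exact: measurable_indic.
  by move=> w; rewrite indicE; case: (_ \in _); rewrite ?normr0 ?normr1.
have iQ := Cyl_integrable cQ.
have ihQ := Cyl_integrable (CylM ch cQ').
have ihU' : Q.-integrable setT (EFin \o (h \_ U)).
  by move/(integrable_mkcond _ mU): ihU; rewrite restrict_EFin.
have -> : \int[Q]_(w in U) h w = \int[Q]_w ((h \_ U) w - h w * Psi w).
  rewrite [LHS]Rintegral_mkcond RintegralB//.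
  by rewrite (Cyl_markov st bf (Cyl_sub Ss cQ)) subr0.
apply: (le_trans (le_normr_Rintegral _ _)) => //; first exact: (integrableB measurableT ihU' ihQ).
apply: (@le_trans _ _ (\int[Q]_w (M * (\1_U w - Psi w)))).
  apply: le_Rintegral => //.
  - exact: integrable_norm (integrableB _ ihU' ihQ).
  - have := integrableZl measurableT M (integrableB measurableT i1 iQ).
    by apply: eq_integrable.
  - move=> w _; rewrite patchE indicE.
    have [Uw|/negP nUw] := boolP (w \in U).
      rewrite -[X in `|X - _|]mulr1 -mulrBr normrM ler_pM//.
      by rewrite ger0_norm// subr_ge0; case/andP: (Q01 w).
    have -> : Psi w = 0.
      apply/le_anti; case/andP: (Q01 w) => -> _; rewrite andbT leNgt.
      by apply/negP => /QV Uw; apply: nUw; exact/mem_set.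
    by rewrite mulr0 !subrr normr0 mulr0.
rewrite RintegralZl//; last exact: (integrableB measurableT i1 iQ).
rewrite RintegralB//.
have -> : \int[Q]_w \1_U w = fine (Q U).
  by rewrite /Rintegral integral_indic// setIT.
rewrite (expectE cQ).
apply: (@le_trans _ _ (M * (e / (M + 1)))); first by rewrite ler_wpM2l.
rewrite mulrCA ger_pMr// ler_pdivrMr// mul1r; lra.
Qed.

(** The open sets of the past are stable under intersection, unlike events at a single time, so the
    pi-system argument can start from them. *)
Lemma natural_filtrationE s : natural_filtration s `<=`
  <<s [set U : set X | measurable U /\ exists S, [/\ countable S,
        S `<=` [set u | leT u s] & cyl_open S U]] >>.
Proof.
apply: smallest_sub; first exact: smallest_sigma_algebra.
move=> _ [u [B [us [mB ->]]]].
set G := [set U | _].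
suff : <<s @open E >> `<=` [set B | <<s G >> (canon_proc u @^-1` B)].
  by move=> h; exact: (h B mB).
have [s0 sC sU] := smallest_sigma_algebra setT G.
apply: smallest_sub; first split.
- by rewrite /= preimage_set0.
- by move=> A /sC /=; rewrite !setTD preimage_setC.
- by move=> A mA /=; rewrite preimage_bigcup; exact: sU.
move=> V oV; apply: sub_sigma_algebra; split.
  by apply: sub_sigma_algebra; exists u, V; split => //; exact: sub_sigma_algebra.
exists [set u]; split; [exact: countable1|by move=> _ ->|].
exact: cyl_open_coord.
Qed.

Lemma markov_natural s t f A : leT s t -> bBrho rho f -> natural_filtration s A ->
  (\int[Q]_(w in A) (f (w t) - P (t%:num - s%:num) f (w s))%:E = 0)%E.
Proof.
move=> st bf /natural_filtrationE; set d := t%:num - s%:num.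
have d0 : 0 <= d by rewrite subr_ge0.
have bPf := feller_bBrho rho_adm hE fP P1 d0 bf.
pose h (w : X) := f (w t) - P d f (w s).
have ch : Cyl setT h by apply: CylB; [exact: Cyl_coord|apply: (Cyl_coord _ bPf)].
apply: integral_eq0_pi_system.
- exact: Cyl_integrable ch.
- by move=> U [].
- move=> U V [mU [S [cS Ss oU]]] [mV [S' [cS' Ss' oV]]]; split.
    exact: measurableI.
  exists (\bigcup_n (if n is 0%N then S else S')); split.
  + by apply: bigcup_countable => // -[|n].
  + by move=> u [[|n] _]; [exact: Ss|exact: Ss'].
  + apply: cyl_openI; first by apply: cyl_open_sub oU => v Sv; exists 0%N.
    by apply: cyl_open_sub oV => v Sv; exists 1%N.
- split; first exact: measurableT.
  exists set0; split => //.
  move=> w _; exists (fun=> 1); split => //; first exact: Cyl_cst.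
  by move=> z; rewrite ler01 lexx.
- by move=> U [mU [S [cS Ss oU]]]; exact: (markov_cyl_open st bf mU cS Ss oU).
Qed.

End path_expectation.

(** * The augmented filtration *)

Section markov_process.
Context {R : realType} {E : ptopologicalType} (rho : E -> R).
Hypothesis rho_adm : admissible_weight rho.
Hypothesis hE : hausdorff_space E.
Hypothesis crE : completely_regular_space E.
Variable P : R -> (E -> R) -> (E -> R).
Hypothesis fP : generalized_Feller rho P.
Hypothesis P1 : forall t : R, 0 <= t -> P t (fun _ => 1) = (fun _ => 1).
Variable nu : probability (Borel E) R.
Hypothesis nu_rho : (\int[nu]_x (rho x)%:E < +oo)%E.
Variable Q : probability (Path R E) R.
Hypothesis QU : forall U : set (Path R E), cyl_copen rho U -> Q U = lam rho P nu U.

Local Notation T := {nonneg R}.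
Local Notation X := (Path R E).
Local Notation Cyl := (Cyl (T := T) rho).
Local Notation L := (Lcyl rho P nu).
Implicit Types (w : X) (s t u : T) (A : set X).

Let expectE := expectE rho_adm hE fP P1 QU.
Let Cyl_integrable S Phi := @Cyl_integrable _ _ _ rho_adm Q S Phi.
Let Cyl_markov := Cyl_markov rho_adm hE fP P1 QU.

(** Truncations of [|g|] at level [n] lie in [bBrho rho], where [expectE] and [L_coord_rho] give a
    bound independent of [n]; monotone convergence extends it to unbounded [g]. *)
Lemma coord_L1 t : exists2 K : R, 0 <= K & forall g (M : R), Brho rho g ->
  (forall x, `|g x| <= M * rho x) ->
  Q.-integrable setT (EFin \o (fun w : X => g (w t))) /\
  \int[Q]_w `|g (w t)| <= K * M.
Proof.
have [K K0 KP] := L_coord_rho rho_adm hE fP P1 nu_rho t.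
exists K => // g M bg gM.
pose g_ (n : nat) x := Num.min `|g x| n%:R.
have bg_ n : bBrho rho (g_ n).
  have bn : Brho rho (fun=> n%:R) by case: (bBrho_cst rho_adm hE n%:R).
  have ba := Brho_norm rho_adm bg.
  have b0 : Brho rho (fun=> 0) by case: (bBrho_cst rho_adm hE 0).
  split; last first.
    exists n%:R => x; rewrite ger0_norm ?ge_min ?lexx ?orbT//.
    by rewrite le_min normr_ge0 ler0n.
  have b1 := Brho_lin rho_adm 1 ba bn.
  have b2 := Brho_norm rho_adm (Brho_lin rho_adm (-1) bn ba).
  have := Brho_lin rho_adm 2^-1 (Brho_lin rho_adm (-1) b2 b1) b0.
  congr Brho; apply/funext => x; rewrite /g_ minr_absE.
  by rewrite [-1 * n%:R + _]addrC !mulN1r; field.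
have mg := Brho_coord_measurable rho_adm t bg.
have mg_ n : measurable_fun setT (fun w : X => (g_ n (w t))%:E).
  apply/measurable_EFinP; apply: (Brho_coord_measurable rho_adm t).
  by case: (bg_ n).
have g0 n w : (0 <= (g_ n (w t))%:E)%E.
  by rewrite lee_fin le_min normr_ge0 ler0n.
have intg n : (\int[Q]_w (g_ n (w t))%:E <= (K * M)%:E)%E.
  have cg : Cyl setT (fun w => g_ n (w t)) by exact: Cyl_coord.
  rewrite -[leLHS]fineK; last exact: integrable_fin_num (Cyl_integrable cg).
  rewrite lee_fin -[leLHS]/(\int[Q]_w g_ n (w t)) (expectE cg).
  apply: le_trans (ler_norm _) _; apply: KP => // x.
  rewrite ger0_norm ?(le_trans _ (gM x)) ?ge_min ?lexx//.
  by rewrite le_min normr_ge0 ler0n.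
have H : (\int[Q]_w `|g (w t)|%:E <= (K * M)%:E)%E.
  have cv : forall w, limn (fun n => (g_ n (w t))%:E) = `|g (w t)|%:E.
    move=> w; apply/cvg_lim => //; apply: cvg_near_cst.
    exists (Num.truncn `|g (w t)|).+1 => // n /= hn.
    rewrite /g_ (min_idPl _)// ltW//.
    by rewrite -truncn_lt_nat.
  have mono : forall w, setT w -> {homo (fun n => (g_ n (w t))%:E) : n m / (n <= m)%N >-> (n <= m)%E}.
    move=> w _ n m nm; rewrite lee_fin /g_ le_min ge_min lexx /= ge_min.
    by rewrite ler_nat nm orbT.
  have := @cvg_monotone_convergence _ _ _ Q setT measurableT
    (fun n (w : X) => (g_ n (w t))%:E) mg_ (fun n w _ => g0 n w) mono.
  rewrite (eq_integral (fun w : X => `|g (w t)|%:E)); last first.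
    by move=> w _; exact: cv.
  move=> c; rewrite -(cvg_lim _ c)//; apply: lime_le; first by apply/cvg_ex; eexists; exact: c.
  by apply: nearW => n; exact: intg.
have ig : Q.-integrable setT (EFin \o (fun w : X => g (w t))).
  apply/integrableP; split; first exact/measurable_EFinP.
  exact: le_lt_trans H (ltry _).
split => //; rewrite -lee_fin; apply: le_trans H.
rewrite /Rintegral fineK//; apply: integrable_fin_num => //.
exact: integrable_norm.
Qed.

Definition tplus t (n : nat) : T := (t%:num + n.+1%:R^-1)%:nng.

Definition tmid t u : T := ((t%:num + u%:num) / 2)%:nng.

Lemma leT_tplus t n : leT t (tplus t n).
Proof. by rewrite /leT /= lerDl. Qed.

Lemma coord_right_cont t f : bBrho rho f ->
  (fun n => \int[Q]_w `|f (w (tplus t n)) - f (w t)|) @ \oo --> (0 : R).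
Proof.
move=> bf; have [Bf [M fM]] := bf.
have M0 : 0 <= M by exact: le_trans (fM point).
have bff := bBrhoM rho_adm bf bf; have [Bff _] := bff.
have h0 n : 0 <= n.+1%:R^-1 :> R by [].
have bP n := feller_bBrho rho_adm hE fP P1 (h0 n) bf.
have bPP n := feller_bBrho rho_adm hE fP P1 (h0 n) bff.
pose g_ n x := P n.+1%:R^-1 (fun y => f y * f y) x
   - 2 * (f x * P n.+1%:R^-1 f x) + f x * f x.
have cft : Cyl [set u | leT u t] (fun w => f (w t)).
  by apply: (Cyl_coord _ bf); rewrite /= /leT.
have cf u : Cyl setT (fun w => f (w u)) by exact: Cyl_coord.
have cff u : Cyl setT (fun w => f (w u) * f (w u)) by exact: CylM.
have cP n u : Cyl setT (fun w => P n.+1%:R^-1 f (w u)) by apply: (Cyl_coord _ (bP n)).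
have cPP n u : Cyl setT (fun w => P n.+1%:R^-1 (fun y => f y * f y) (w u)).
  by apply: (Cyl_coord _ (bPP n)).
have cg n : Cyl setT (fun w => g_ n (w t)).
  by apply: CylD => //; apply: CylB => //; apply/CylZ/CylM.
have cD n : Cyl setT (fun w => f (w (tplus t n)) - f (w t)) by exact: CylB.
have cD2 n : Cyl setT (fun w => (f (w (tplus t n)) - f (w t)) * (f (w (tplus t n)) - f (w t))).
  by apply: CylM.
have sq n : \int[Q]_w ((f (w (tplus t n)) - f (w t)) * (f (w (tplus t n)) - f (w t)))
    = \int[Q]_w g_ n (w t).
  apply/eqP; rewrite -subr_eq0 -RintegralB//; last 2 first.
  - exact: Cyl_integrable (cD2 n).
  - exact: Cyl_integrable (cg n).
  have dE : (tplus t n)%:num - t%:num = n.+1%:R^-1 by rewrite /=; ring.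
  (* The integrands differ by a combination of two Markov identities, for [f * f] against 1 and for
     [f] against [f (w t)]. *)
  have := Cyl_markov (leT_tplus t n) bff (Cyl_cst rho _ 1).
  have := Cyl_markov (leT_tplus t n) bf cft; rewrite dE => I1 I2.
  have cA : Cyl setT (fun w => (f (w (tplus t n)) * f (w (tplus t n)) -
      P n.+1%:R^-1 (fun y => f y * f y) (w t)) * 1).
    by apply: CylM; [exact: CylB|exact: Cyl_cst].
  have cB : Cyl setT (fun w => (f (w (tplus t n)) - P n.+1%:R^-1 f (w t)) * f (w t)).
    by apply: CylM => //; exact: CylB.
  have -> : \int[Q]_w ((f (w (tplus t n)) - f (w t)) * (f (w (tplus t n)) - f (w t)) - g_ n (w t)) =
      \int[Q]_w ((f (w (tplus t n)) * f (w (tplus t n)) -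
      P n.+1%:R^-1 (fun y => f y * f y) (w t)) * 1 -
      2 * ((f (w (tplus t n)) - P n.+1%:R^-1 f (w t)) * f (w t))).
    by apply: eq_Rintegral => w _; rewrite /g_; ring.
  rewrite RintegralB//; last 2 first.
  - exact: Cyl_integrable cA.
  - exact: Cyl_integrable (CylZ 2 cB).
  by rewrite RintegralZl ?I1 ?I2 ?mulr0 ?subrr//; exact: Cyl_integrable cB.
have gcvg x : g_ n x @[n --> \oo] --> (0 : R).
  have hs : (forall n : nat, n.+1%:R^-1 > 0 :> R) /\
      ((n.+1%:R^-1 : R) @[n --> \oo] --> (0 : R)).
    by split => [n|]; [rewrite invr_gt0|exact: cvg_harmonic].
  have c1 := (@cvg_at_rightP R (fun h => P h f x) 0 (f x)).1 (feller_cvg fP Bf) _ hs.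
  have c2 := (@cvg_at_rightP R (fun h => P h (fun y => f y * f y) x) 0 _).1
    (feller_cvg fP Bff) _ hs.
  have -> : 0 = f x * f x - 2 * (f x * f x) + f x * f x by ring.
  apply: cvgD; last exact: cvg_cst.
  apply: cvgB => //; apply: cvgM; first exact: cvg_cst.
  by apply: cvgM => //; exact: cvg_cst.
(* [4 = 1 + 2 + 1]: by contraction the three terms are bounded by [M^2], [2 M^2] and [M^2],
   uniformly in [n], as dominated convergence requires. *)
have gM n x : `|g_ n x| <= 4 * (M * M).
  have ffM y : `|f y * f y| <= M * M by rewrite normrM ler_pM.
  have p1 := feller_norm rho_adm hE fP P1 (h0 n) Bff ffM x.
  have p2 : `|f x * P n.+1%:R^-1 f x| <= M * M.
    by rewrite normrM ler_pM// (feller_norm rho_adm hE fP P1 (h0 n) Bf fM).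
  have p3 := ffM x.
  by move: p1 p2 p3; rewrite /g_ !ler_norml; lra.
have Icvg : \int[Q]_w g_ n (w t) @[n --> \oo] --> (0 : R).
  have : (\int[Q]_w (g_ n (w t))%:E)%E @[n --> \oo] --> (\int[Q]_(w in setT) (cst 0%E w))%E.
    apply: (@dominated_cvg _ _ _ Q setT measurableT
      (fun n (w : X) => (g_ n (w t))%:E) (cst 0%E) (cst (4 * (M * M))%:E)) => //.
    - by move=> n; apply/measurable_EFinP; exact: (Cyl_measurable rho_adm (cg n)).
    - move=> w _; apply: cvg_EFin; [exact: nearW|exact: gcvg].
    - exact: finite_measure_integrable_cst.
    - by move=> n w _; rewrite lee_fin; exact: gM.
  by rewrite integral0 => /fine_cvg.
apply/cvgrPdist_lt => e e0.
(* With threshold [(e/4)^2] for the second moment, [|D| <= e/4 + D^2/(e/4)] integrates to less than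
   [e/2]. *)
have e20 : 0 < e / 4 * (e / 4) by rewrite mulr_gt0 ?divr_gt0.
have := Icvg; move/cvgrPdist_lt => /(_ _ e20); apply: filterS => n.
rewrite !sub0r !normrN -sq => hn.
rewrite ger0_norm; last by apply: Rintegral_ge0 => w _; exact: normr_ge0.
have e4 : 0 < e / 4 by rewrite divr_gt0.
pose D (w : X) := f (w (tplus t n)) - f (w t).
apply: (@le_lt_trans _ _ (\int[Q]_w (e / 4 + (e / 4)^-1 * (D w * D w)))).
  have cR : Cyl setT (fun w => e / 4 + (e / 4)^-1 * (D w * D w)).
    by apply: CylD; [exact: Cyl_cst|apply: CylZ; exact: (cD2 n)].
  apply: le_Rintegral => //.
  - exact: integrable_norm (Cyl_integrable (cD n)).
  - exact: Cyl_integrable cR.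
  - move=> w _; rewrite -/(D w).
    have -> : D w * D w = `|D w| * `|D w| by rewrite -normrM ger0_norm// -expr2 sqr_ge0.
    set a := `|D w|; have a0 : 0 <= a by exact: normr_ge0.
    have [ae|ae] := leP a (e / 4).
      rewrite (le_trans ae)// lerDl; apply: mulr_ge0; last exact: mulr_ge0.
      by rewrite invr_ge0 ltW.
    apply: (@le_trans _ _ ((e / 4)^-1 * (a * a))); last by rewrite lerDr ltW.
    rewrite mulrA ler_peMl// mulrC ler_pdivlMr// mul1r ltW//.
have i1 : Q.-integrable setT (EFin \o (cst (e / 4) : X -> R)).
  exact: finite_measure_integrable_cst.
have QT : Q setT = 1%E by exact: probability_setT.
have Ecst : \int[Q]_w (cst (e / 4) w) = e / 4.
  transitivity (e / 4 * fine (Q setT)); first exact: Rintegral_cst.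
  by rewrite QT mulr1.
rewrite (RintegralD _ i1 (Cyl_integrable (CylZ _ (cD2 n))))// Ecst.
rewrite (RintegralZl _ _ (Cyl_integrable (cD2 n)))//.
have : (e / 4)^-1 * \int[Q]_w (D w * D w) < e / 4.
  rewrite mulrC ltr_pdivrMr//; apply: le_lt_trans hn; exact: ler_norm.
rewrite /D; lra.
Qed.

Lemma natural_filtration_measurable s : natural_filtration s `<=` (measurable : set (set X)).
Proof.
apply: smallest_sub; first exact: sigma_algebra_measurable.
move=> _ [u [B [_ [mB ->]]]]; apply: sub_sigma_algebra.
by exists u, B.
Qed.

Definition symdiff A B := (A `\` B) `|` (B `\` A).

(** Right limit and null sets in one definition: [B] and its exceptional null set may depend on [u].
    Measurability of [A] keeps the filtration inside the product sigma-algebra, with respect to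
    which completeness is meant. *)
Definition augmented t : set (set X) := [set A | measurable A /\
  forall u, t%:num < u%:num -> exists2 B, natural_filtration u B &
    Q.-negligible (symdiff A B)].

Lemma integral_symdiff (h : X -> R) A B : Q.-integrable setT (EFin \o h) ->
  measurable A -> measurable B -> Q.-negligible (symdiff A B) ->
  (\int[Q]_(w in A) (h w)%:E = \int[Q]_(w in B) (h w)%:E)%E.
Proof.
move=> ih mA mB nAB.
have mN : measurable (symdiff A B) by apply: measurableU; exact: measurableD.
have N0 : Q (symdiff A B) = 0%E by exact/negligibleP.
rewrite (negligible_integral mN mA _ N0); last exact: integrableS ih.
rewrite (negligible_integral mN mB _ N0); last exact: integrableS ih.
congr (integral _ _ _); apply/seteqP; split => w [].
- move=> Aw nN; split => //; apply: contrapT => nBw; apply: nN; left; split => //.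
- move=> Bw nN; split => //; apply: contrapT => nAw; apply: nN; right; split => //.
Qed.

Lemma norm_Rintegral_sub (h : X -> R) A : Q.-integrable setT (EFin \o h) ->
  measurable A -> `|\int[Q]_(w in A) h w| <= \int[Q]_w `|h w|.
Proof.
move=> ih mA; have ihA : Q.-integrable A (EFin \o h) by exact: integrableS ih.
apply: (le_trans (le_normr_Rintegral _ _)) => //.
rewrite Rintegral_mkcond; apply: le_Rintegral => //.
- have := integrable_norm ihA; move/(integrable_mkcond _ mA).
  by rewrite restrict_EFin.
- exact: integrable_norm ih.
- by move=> w _; rewrite patchE; case: ifP => // _; exact: normr_ge0.
Qed.

Lemma markov_augmented_bounded s t f A : leT s t -> bBrho rho f -> augmented s A ->
  (\int[Q]_(w in A) (f (w t) - P (t%:num - s%:num) f (w s))%:E = 0)%E.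
Proof.
move=> st bf [mA aA]; set d := t%:num - s%:num.
have d0 : 0 <= d by rewrite subr_ge0.
have bPf := feller_bBrho rho_adm hE fP P1 d0 bf.
have cf u : Cyl setT (fun w => f (w u)) by exact: Cyl_coord.
have cPf u : Cyl setT (fun w => P d f (w u)) by apply: (Cyl_coord _ bPf).
pose h n (w : X) := f (w (tplus t n)) - P d f (w (tplus s n)).
have ch n : Cyl setT (h n) by exact: CylB.
pose h0 (w : X) := f (w t) - P d f (w s).
have ch0 : Cyl setT h0 by exact: CylB.
have hn0 n : (\int[Q]_(w in A) (h n w)%:E = 0)%E.
  have [|B nB AB] := aA (tplus s n); first by rewrite /= ltrDl invr_gt0.
  have mB := natural_filtration_measurable nB.
  rewrite (integral_symdiff (Cyl_integrable (ch n)) mA mB AB).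
  (* The common shift leaves the lag equal to [d], so the same function [P d f] appears for all
     [n]. *)
  have stn : leT (tplus s n) (tplus t n) by rewrite /leT /= lerD2r.
  have := markov_natural rho_adm hE crE fP P1 QU stn bf nB.
  by rewrite (_ : (tplus t n)%:num - (tplus s n)%:num = d)//=; rewrite /d; ring.
have ihA (g : X -> R) : Cyl setT g -> Q.-integrable A (EFin \o g).
  by move=> cg; apply: integrableS (Cyl_integrable cg).
suff r0 : \int[Q]_(w in A) h0 w = 0.
  rewrite -[LHS]fineK ?[fine _]r0//.
  by apply: integrable_fin_num => //; exact: ihA.
apply/eqP; rewrite -normr_le0; apply/ler_addgt0Pr => e e0; rewrite add0r.
have e2 : 0 < e / 2 by rewrite divr_gt0.
have := coord_right_cont t bf; move/cvgrPdist_lt => /(_ _ e2) [N1 _ H1].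
have := coord_right_cont s bPf; move/cvgrPdist_lt => /(_ _ e2) [N2 _ H2].
pose n := maxn N1 N2.
have {}H1 := H1 n (leq_maxl _ _); have {}H2 := H2 n (leq_maxr _ _).
rewrite /= sub0r normrN in H1; rewrite /= sub0r normrN in H2.
have c1 : Cyl setT (fun w => f (w (tplus t n)) - f (w t)) by exact: CylB.
have c2 : Cyl setT (fun w => P d f (w (tplus s n)) - P d f (w s)) by exact: CylB.
have i1 := integrable_norm (Cyl_integrable c1).
have i2 := integrable_norm (Cyl_integrable c2).
have i12 := integrableD measurableT i1 i2.
have -> : \int[Q]_(w in A) h0 w = \int[Q]_(w in A) (h0 w - h n w).
  rewrite RintegralB//; [|exact: ihA|exact: ihA].
  by rewrite [X in _ - X]/Rintegral hn0 subr0.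
apply: (le_trans (norm_Rintegral_sub (Cyl_integrable (CylB ch0 (ch n))) mA)).
apply: (@le_trans _ _ (\int[Q]_w (`|f (w (tplus t n)) - f (w t)| +
    `|P d f (w (tplus s n)) - P d f (w s)|))).
  apply: le_Rintegral => //.
  - exact: integrable_norm (Cyl_integrable (CylB ch0 (ch n))).
  - move=> w _; rewrite /h0 /h.
    have -> : f (w t) - P d f (w s) - (f (w (tplus t n)) - P d f (w (tplus s n))) =
      (P d f (w (tplus s n)) - P d f (w s)) - (f (w (tplus t n)) - f (w t)) by ring.
    by rewrite (le_trans (ler_normB _ _))// addrC.
rewrite RintegralD//.
have := le_lt_trans (ler_norm _) H1; have := le_lt_trans (ler_norm _) H2; lra.
Qed.

(** [f] is replaced by a bounded continuous [g] with weighted error [e / k]. The two sides then move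
    by at most [Kt] and [Ks * C] times [e / k], and [k] is the sum of these factors plus 1. *)
Lemma markov_augmented s t f A : leT s t -> Brho rho f -> augmented s A ->
  (\int[Q]_(w in A) (f (w t))%:E =
   \int[Q]_(w in A) (P (t%:num - s%:num) f (w s))%:E)%E.
Proof.
move=> st bf aA; have [mA _] := aA; set d := t%:num - s%:num.
have d0 : 0 <= d by rewrite subr_ge0.
have [Kt Kt0 HKt] := coord_L1 t; have [Ks Ks0 HKs] := coord_L1 s.
have [C C0 HC] := feller_rho rho_adm fP d0.
have bPf := feller_Brho fP d0 bf.
have iB u g : Brho rho g -> Q.-integrable setT (EFin \o (fun w : X => g (w u))).
  move=> bg; have [K _ HK] := coord_L1 u.
  by have /(BrhoP rho_adm)[[M gM] _] := bg; have [] := HK g M bg gM.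
have iBA u g : Brho rho g -> Q.-integrable A (EFin \o (fun w : X => g (w u))).
  by move=> bg; apply: integrableS (iB u g bg).
have fA u g : Brho rho g -> (\int[Q]_(w in A) (g (w u))%:E)%E \is a fin_num.
  by move=> bg; apply: integrable_fin_num => //; exact: iBA.
suff r0 : \int[Q]_(w in A) f (w t) = \int[Q]_(w in A) P d f (w s).
  by rewrite -[LHS]fineK ?fA// -[RHS]fineK ?fA//; congr EFin.
apply/eqP; rewrite -subr_eq0 -normr_le0; apply/ler_addgt0Pr => e e0; rewrite add0r.
pose k := Kt + Ks * C + 1.
have k0 : 0 < k by rewrite /k ltr_wpDl// addr_ge0// mulr_ge0.
have /(BrhoP rho_adm)[_ /(_ (e / k))] := bf; rewrite divr_gt0// => /(_ isT)[g cg fg].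
have bg := bBrho_Cb rho_adm hE cg; have [Bg _] := bg.
have BPg := feller_Brho fP d0 Bg.
pose q x := -1 * g x + f x.
have Bq : Brho rho q by exact: Brho_lin.
have qle x : `|q x| <= e / k * rho x by rewrite /q mulN1r addrC.
have PqE x : P d q x = P d f x - P d g x.
  by rewrite /q (feller_lin fP)// mulN1r addrC.
have Bq' := feller_Brho fP d0 Bq.
have [_ I1] := HKt q (e / k) Bq qle.
have [_ I2] := HKs (P d q) (C * (e / k)) Bq' (HC q (e / k) Bq qle).
have M0 := markov_augmented_bounded st bg aA.
have {M0}M0 : \int[Q]_(w in A) g (w t) - \int[Q]_(w in A) P d g (w s) = 0.
  by rewrite -RintegralB//; [rewrite /Rintegral M0|exact: iBA|exact: iBA].
have -> : \int[Q]_(w in A) f (w t) - \int[Q]_(w in A) P d f (w s) =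
    \int[Q]_(w in A) q (w t) - \int[Q]_(w in A) P d q (w s).
  have -> : \int[Q]_(w in A) q (w t) =
      \int[Q]_(w in A) f (w t) - \int[Q]_(w in A) g (w t).
    rewrite -RintegralB//; [|exact: iBA|exact: iBA].
    by apply: eq_Rintegral => w _; rewrite /q mulN1r addrC.
  have -> : \int[Q]_(w in A) P d q (w s) =
      \int[Q]_(w in A) P d f (w s) - \int[Q]_(w in A) P d g (w s).
    rewrite -RintegralB//; [|exact: iBA|exact: iBA].
    by apply: eq_Rintegral => w _; rewrite PqE.
  by move: M0; lra.
have bnd u h : Brho rho h -> `|\int[Q]_(w in A) h (w u)| <= \int[Q]_w `|h (w u)|.
  by move=> bh; apply: norm_Rintegral_sub => //; exact: iB.
rewrite (le_trans (ler_normB _ _))//.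
rewrite (le_trans (lerD (bnd t q Bq) (bnd s (P d q) Bq')))//.
rewrite (le_trans (lerD I1 I2))//.
rewrite (_ : _ + _ = (Kt + Ks * C) / k * e); last by field; rewrite gt_eqF.
by rewrite ger_pMl// ler_pdivrMr// mul1r /k lerDl.
Qed.

Lemma augmented_sigma_algebra t : sigma_algebra setT (augmented t).
Proof.
have sF u : sigma_algebra setT (natural_filtration u : set (set X)).
  exact: smallest_sigma_algebra.
split.
- split; first exact: measurable0.
  move=> u _; exists set0; first by case: (sF u).
  by rewrite /symdiff setDv setU0; exact: negligible_set0.
- move=> A [mA aA]; rewrite setTD; split; first exact: measurableC.
  move=> u /aA[B nB AB]; exists (~` B).
    by case: (sF u) => _ /(_ B nB); rewrite setTD.
  apply: negligibleS AB => w [[nA nB']|[nB' nA]].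
    by right; split => //; apply: contrapT.
  by left; split => //; apply: contrapT.
- move=> A aA; split.
    by apply: bigcupT_measurable => n; case: (aA n).
  move=> u tu; have /choice[B BP] : forall n, exists B, natural_filtration u B /\
      Q.-negligible (symdiff (A n) B).
    by move=> n; have [_ /(_ u tu)[B]] := aA n; exists B.
  exists (\bigcup_n B n).
    by case: (sF u) => _ _; apply => n; case: (BP n).
  apply: (@negligibleS _ _ _ _ (\bigcup_n symdiff (A n) (B n))); last first.
    by apply: negligible_bigcup => n; case: (BP n).
  move=> w [[[n _ Aw] nB]|[[n _ Bw] nA]]; exists n => //.
    by left; split => // Bw; apply: nB; exists n.
  by right; split => // Aw; apply: nA; exists n.
Qed.

Lemma natural_filtration_mono s t : s%:num <= t%:num ->
  natural_filtration s `<=` (natural_filtration t : set (set X)).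
Proof.
move=> st; apply: sub_sigma_algebra2 => _ [u [B [us [mB ->]]]].
by exists u, B; split => //; exact: le_trans us st.
Qed.

Lemma natural_filtration_augmented t : natural_filtration t `<=` augmented t.
Proof.
move=> A nA; split; first exact: natural_filtration_measurable nA.
move=> u tu; exists A; first exact: natural_filtration_mono (ltW tu) _ nA.
by rewrite /symdiff setDv setU0; exact: negligible_set0.
Qed.

Lemma augmented_mono s t : s%:num <= t%:num -> augmented s `<=` augmented t.
Proof.
by move=> st A [mA aA]; split => // u tu; apply: aA; exact: le_lt_trans tu.
Qed.

Lemma augmented_right_cont t : augmented t =
  \bigcap_(u in [set u : T | t%:num < u%:num]) augmented u.
Proof.
apply/seteqP; split => A.
  by move=> aA u /ltW tu; exact: augmented_mono tu _ aA.
move=> aA; split.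
  by have [] := aA (tplus t 0) _; rewrite //= ltrDl invr_gt0.
(* A time strictly between [t] and [u] absorbs the strict inequality: membership in [augmented v]
   provides an approximant in [natural_filtration u]. *)
move=> u tu; pose v := tmid t u.
have tv : t%:num < v%:num by rewrite /=; lra.
by have [_] := aA v tv; apply; rewrite /=; lra.
Qed.

Lemma augmented_complete t N : measurable N -> Q N = 0%E -> augmented t N.
Proof.
move=> mN N0; split => // u _; exists set0.
  by case: (smallest_sigma_algebra setT [set A : set X | exists (u0 : T) (B : set E),
             u0%:num <= u%:num /\ <<s @open E >> B /\ A = canon_proc u0 @^-1` B]).
by rewrite /symdiff setD0 set0D setU0; exact/negligibleP.
Qed.

Lemma coord_augmented t (B : set E) : <<s @open E >> B ->
  augmented t (canon_proc t @^-1` B).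
Proof.
move=> mB; apply: natural_filtration_augmented; apply: sub_sigma_algebra.
by exists t, B.
Qed.

Lemma markov_cond_exp s t f : s%:num <= t%:num -> Brho rho f ->
  cond_exp_ae Q (augmented s) (fun w => f (canon_proc t w))
                              (fun w => P (t%:num - s%:num) f (canon_proc s w)).
Proof.
move=> st bf; set d := t%:num - s%:num.
have d0 : 0 <= d by rewrite subr_ge0.
have bPf := feller_Brho fP d0 bf.
have iB u g : Brho rho g -> Q.-integrable setT (EFin \o (fun w : X => g (w u))).
  move=> bg; have [K _ HK] := coord_L1 u.
  by have /(BrhoP rho_adm)[[M gM] _] := bg; have [] := HK g M bg gM.
split; first exact: iB.
exists (fun w => P d f (w s)); split.
  move=> B mB; apply: (@coord_augmented s (P d f @^-1` B)).
  have := Brho_measurable rho_adm bPf measurableT mB.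
  by rewrite setTI.
split; first exact: iB.
split; first by move=> A aA; exact: markov_augmented.
exact: aeW.
Qed.

End markov_process.

Theorem mainTheorem5 (R : realType) (E : ptopologicalType) (rho : E -> R)
  (P : R -> (E -> R) -> (E -> R)) :
  completely_regular_space E -> hausdorff_space E ->
  admissible_weight rho ->
  generalized_Feller rho P ->
  (forall t : R, 0 <= t -> P t (fun _ => 1) = (fun _ => 1)) ->
  forall nu : probability (Borel E) R, in_Mrho rho nu ->
  exists (Pnu : probability (Path R E) R)
         (F : {nonneg R} -> set (set (Path R E))),
    (* (F t) is a filtration of sub-sigma-algebras of the product sigma-algebra *)
    (forall t, sigma_algebra setT (F t)) /\
    (forall t, F t `<=` measurable) /\
    (forall s t : {nonneg R}, s%:num <= t%:num -> F s `<=` F t) /\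
    (* complete *)
    (forall t (N : set (Path R E)), measurable N -> Pnu N = 0%E -> F t N) /\
    (* right-continuous *)
    (forall t, F t = \bigcap_(u in [set u : {nonneg R} | t%:num < u%:num]) F u) /\
    (* contains the natural filtration of the canonical process *)
    (forall t, natural_filtration t `<=` F t) /\
    (* the canonical process is adapted *)
    (forall t (B : set E), <<s @open E >> B -> F t (canon_proc t @^-1` B)) /\
    (* initial law *)
    (forall B : set (Borel E), measurable B -> Pnu (canon_proc 0%:nng @^-1` B) = nu B) /\
    (* Markov property *)
    (forall s t : {nonneg R}, s%:num <= t%:num ->
      forall f : E -> R, Brho rho f ->
        cond_exp_ae Pnu (F s) (fun w => f (canon_proc t w))
                              (fun w => P (t%:num - s%:num) f (canon_proc s w))).
Proof.
move=> crE hE rho_adm fP P1 nu [nu_reg nu_rho].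
have [Q QU] := path_probability_exists rho_adm hE crE fP P1 nu_rho.
exists Q, (augmented Q); split; first exact: augmented_sigma_algebra.
split; first by move=> t A [].
split; first exact: augmented_mono.
split; first exact: augmented_complete.
split; first exact: augmented_right_cont.
split; first exact: natural_filtration_augmented.
split; first exact: coord_augmented.
split; first by move=> B mB; exact: (initial_law rho_adm hE crE fP P1 QU).
by move=> s t st f bf; exact: (markov_cond_exp rho_adm hE crE fP P1 nu_rho QU st bf).
Qed.
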